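(* Let $p,q$ be odd primes with $p\equiv1\pmod q$. The ribbon factorizable Hopf algebra $A(p,q)$ is not a tensor product of trivial Hopf algebras and Drinfel'd doubles.
   Context: $\Bbbk$ is an algebraically closed field of characteristic $0$; all Hopf algebras are finite-dimensional over $\Bbbk$. A Hopf algebra is called trivial if it is a group algebra or the dual of a group algebra. A Drinfel'd double means $D(H)$ for some Hopf algebra $H$. The Hopf algebra $\mathscr A_0$: fix $t\in\mathbb N$ with $t^q\equiv1\pmod p$, $t\not\equiv1\pmod p$. Let $G=\langle a,b\mid a^p=b^q=1,\ bab^{-1}=a^t\rangle$ and $F=\langle x\mid x^q=1\rangle$, with $F$ acting on $G$ on the right by automorphisms: $a\triangleleft x^i=a^{t^i}$, $b\triangleleft x^i=b$. As a vector space $\mathscr A_0=\Bbbk^G\otimes\Bbbk F$ with basis $e_g\#f$ ($e_g$ the delta functions), product $(e_g\#f)(e_{g'}\#f')=\delta_{g\triangleleft f,g'}\,e_g\#ff'$, coproduct $\Delta(e_g\#f)=\sum_{g'g''=g}(e_{g'}\#f)\otimes(e_{g''}\#f)$, unit $\sum_ge_g\#1$, counit $\epsilon(e_g\#f)=\delta_{g,1}$, antipode $S(e_g\#f)=e_{(g\triangleleft f)^{-1}}\#f^{-1}$. Write $e_g=e_g\#1$ and $x=\sum_ge_g\#x$. Drinfel'd double: as a coalgebra $D(H)=(H^* )^{cop}\otimes H$, with $(f\otimes h)(g\otimes k)=f[h_{(1)}\rightharpoonup g\leftharpoonup S^{-1}(h_{(3)})]\otimes h_{(2)}k$, where $\langle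 a\rightharpoonup g\leftharpoonup b,c\rangle=\langle g,bca\rangle$; write $fh$ for $f\otimes h$. Its standard universal $\mathcal R$-matrix is $\sum_ih_i\otimes h^i$ with dual bases of $H$ and $H^*$. $A(p,q)$: let $\omega\in\Bbbk$ be a primitive $q$-th root of unity and $\chi:\mathscr A_0\to\Bbbk$ the algebra map with $\chi(e_g)=\delta_{g,b}$, $\chi(x)=\omega$. Then $\chi x$ is a central group-like element of $D(\mathscr A_0)$, and $A(p,q)=D(\mathscr A_0)/I$ with $I=D(\mathscr A_0)\langle\chi x\rangle^+$, where $\langle\chi x\rangle^+$ is the kernel of the counit on the group algebra of $\langle\chi x\rangle$. It is ribbon factorizable with the $\mathcal R$-matrix induced from the standard one of $D(\mathscr A_0)$. *)

(* Defs.v *)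
From HB Require Import structures.
From mathcomp Require Import all_boot all_order all_algebra all_fingroup all_field.

Set Implicit Arguments.
Unset Strict Implicit.
Unset Printing Implicit Defensive.

Import GRing.Theory.
Local Open Scope ring_scope.

(* V (x) W is realized as a space of matrices, through the library bases
   [vbasis {:V}] and [vbasis {:W}]; [tlift_pure] and [tlift_uniq] below give
   its universal property, and nothing else about the model is used. *)
Section Tensor.
Variable k : fieldType.

Definition bas (V : vectType k) (i : 'I_(\dim {:V})) : V := (vbasis {:V})`_i.

Definition tensor (V W : vectType k) : vectType k :=
  'M[k]_(\dim {:V}, \dim {:W}).

Definition pure (V W : vectType k) (v : V) (w : W) : tensor V W :=
  \matrix_(i, j) (coord (vbasis {:V}) i v * coord (vbasis {:W}) j w).

(* The linear map V (x) W -> U induced by a bilinear b : V -> W -> U. *)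
Definition tlift (V W U : vectType k) (b : V -> W -> U) (z : tensor V W) : U :=
  \sum_i \sum_j z i j *: b (bas i) (bas j).

Definition bilin (V W U : vectType k) (b : V -> W -> U) : Prop :=
  (forall v, linear (b v)) /\ (forall w, linear (b^~ w)).

End Tensor.

Notation "v \ot w" := (pure v w) (at level 40, left associativity).

Section TensorTheory.
Variable k : fieldType.
Variables V W U : vectType k.

Lemma coord_bas (X : vectType k) (v : X) :
  v = \sum_i coord (vbasis {:X}) i v *: bas i.
Proof. exact: (coord_vbasis (memvf v)). Qed.

Lemma bilin_sum (b : V -> W -> U) I J (r : seq I) (s : seq J)
    (c : I -> k) (d : J -> k) (v : I -> V) (w : J -> W) : bilin b ->
  b (\sum_(i <- r) c i *: v i) (\sum_(j <- s) d j *: w j) =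
  \sum_(i <- r) \sum_(j <- s) (c i * d j) *: b (v i) (w j).
Proof.
move=> [br bl].
have br0 x : b x 0 = 0.
  by have := br x (-1) 0 0; rewrite scaler0 addr0 scaleN1r => ->; rewrite addNr.
have bl0 y : b 0 y = 0.
  by have /= := bl y (-1) 0 0; rewrite scaler0 addr0 scaleN1r => ->; rewrite addNr.
have sumr x : b x (\sum_(j <- s) d j *: w j) = \sum_(j <- s) d j *: b x (w j).
  elim: s => [|j s IHs]; first by rewrite !big_nil.
  by rewrite !big_cons br IHs.
elim: r => [|i r IHr]; first by rewrite !big_nil bl0.
rewrite !big_cons; have /= -> := bl (\sum_(j <- s) d j *: w j).
rewrite IHr sumr scaler_sumr; congr (_ + _).
by apply: eq_bigr => j _; rewrite scalerA.
Qed.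

Lemma tlift_pure (b : V -> W -> U) (v : V) (w : W) :
  bilin b -> tlift b (v \ot w) = b v w.
Proof.
move=> hb; rewrite {2}(coord_bas v) {2}(coord_bas w) bilin_sum //.
by apply: eq_bigr => i _; apply: eq_bigr => j _; rewrite mxE.
Qed.

Lemma tlift_linear (b : V -> W -> U) : linear (tlift b).
Proof.
move=> c x y; rewrite /tlift scaler_sumr -big_split; apply: eq_bigr => i _.
rewrite scaler_sumr -big_split; apply: eq_bigr => j _ /=.
by rewrite !mxE scalerDl scalerA.
Qed.

Lemma pure_bilin : bilin (@pure k V W).
Proof.
split=> [v c x y|w c x y]; apply/matrixP=> i j; rewrite !mxE linearP /=.
  by rewrite mulrDr mulrCA.
by rewrite mulrDl mulrA.
Qed.

Lemma tensor_sum (z : tensor V W) : z = tlift (fun v w => v \ot w) z.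
Proof.
apply/matrixP=> i j; rewrite /tlift summxE (bigD1 i) //= summxE (bigD1 j) //=.
have coordE (X : vectType k) (m n : 'I_(\dim {:X})) :
    coord (vbasis {:X}) m (bas n) = (n == m)%:R.
  by rewrite /bas coord_free ?(basis_free (vbasisP _)) // eq_sym.
rewrite !mxE !coordE !eqxx !mulr1 !big1 ?addr0 // => [m nmi|n nnj].
  rewrite summxE big1 // => n _.
  by rewrite !mxE !coordE (negPf nmi) mul0r mulr0.
by rewrite !mxE !coordE (negPf nnj) mulr0 mulr0.
Qed.

Lemma tlift_uniq (f g : tensor V W -> U) : linear f -> linear g ->
  (forall v w, f (v \ot w) = g (v \ot w)) -> f =1 g.
Proof.
move=> lf lg fg z.
have lin0 (h : tensor V W -> U) : linear h -> h 0 = 0.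
  by move=> lh; have := lh (-1) 0 0; rewrite scaler0 addr0 scaleN1r => ->; rewrite addNr.
have lin_sum (h : tensor V W -> U) I (r : seq I) c F : linear h ->
    h (\sum_(i <- r) c i *: F i) = \sum_(i <- r) c i *: h (F i).
  move=> lh; elim: r => [|i r IHr]; first by rewrite !big_nil lin0.
  by rewrite !big_cons lh IHr.
rewrite (tensor_sum z) /tlift pair_big !lin_sum //=.
by apply: eq_bigr => ij _; rewrite fg.
Qed.

End TensorTheory.

(* The structure maps without the axioms; the latter are collected in
   [is_hopf]. *)
Record hopf_data (k : fieldType) := HopfData {
  carrier :> vectType k;
  hmul : carrier -> carrier -> carrier;
  hone : carrier;
  comul : carrier -> tensor carrier carrier;
  counit : carrier -> k^o;
  antipode : carrier -> carrier }.

Arguments hone {k} h : rename.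

Section Hopf.
Variable k : fieldType.

(* Sweedler notation: [sw2 (fun h1 h2 => E) h] is the sum of the E over
   Delta h = h1 (x) h2, for E bilinear in (h1, h2); similarly [sw3]. *)
Definition sw2 (H : hopf_data k) (U : vectType k) (b : H -> H -> U) (h : H) : U :=
  tlift b (comul h).

Definition sw3 (H : hopf_data k) (U : vectType k) (b : H -> H -> H -> U)
    (h : H) : U :=
  sw2 (fun h1 h' => sw2 (fun h2 h3 => b h1 h2 h3) h') h.

Record is_hopf (H : hopf_data k) : Prop := IsHopf {
  hmul_bilin : bilin (@hmul k H);
  comul_linear : linear (@comul k H);
  counit_linear : linear (@counit k H);
  antipode_linear : linear (@antipode k H);
  hmulA : associative (@hmul k H);
  hmul1l : left_id (hone H) (@hmul k H);
  hmul1r : right_id (hone H) (@hmul k H);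
  comulA : forall h : H,
    sw2 (fun h1 h2 => sw2 (fun h21 h22 => h1 \ot (h21 \ot h22)) h2) h =
    sw2 (fun h1 h2 => sw2 (fun h11 h12 => h11 \ot (h12 \ot h2)) h1) h;
  counit1l : forall h : H, sw2 (fun h1 h2 => counit h1 *: h2) h = h;
  counit1r : forall h : H, sw2 (fun h1 h2 => counit h2 *: h1) h = h;
  comulM : forall g h : H, comul (hmul g h) =
    sw2 (fun g1 g2 => sw2 (fun h1 h2 => hmul g1 h1 \ot hmul g2 h2) h) g;
  comul1 : comul (hone H) = hone H \ot hone H;
  counitM : forall g h : H, counit (hmul g h) = counit g * counit h;
  counit1 : counit (hone H) = 1;
  antipodel : forall h : H,
    sw2 (fun h1 h2 => hmul (antipode h1) h2) h = counit h *: hone H;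
  antipoder : forall h : H,
    sw2 (fun h1 h2 => hmul h1 (antipode h2)) h = counit h *: hone H }.

(* Between Hopf algebras such a map automatically commutes with antipodes. *)
Record hopf_morphism (A B : hopf_data k) (f : 'Hom(A, B)) : Prop := HopfMorphism {
  morph_hmul : forall x y, f (hmul x y) = hmul (f x) (f y);
  morph_hone : f (hone A) = hone B;
  morph_comul : forall x, comul (f x) = sw2 (fun x1 x2 => f x1 \ot f x2) x;
  morph_counit : forall x, counit (f x) = counit x }.

Definition hopf_iso (A B : hopf_data k) : Prop :=
  exists2 f : 'Hom(A, B), hopf_morphism f & bijective f.

Definition tensor_hopf (A B : hopf_data k) : hopf_data k :=
  @HopfData k (tensor A B)
    (fun z w => tlift (fun a b =>
       tlift (fun a' b' => hmul a a' \ot hmul b b') w) z)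
    (hone A \ot hone B)
    (tlift (fun a b =>
       sw2 (fun a1 a2 => sw2 (fun b1 b2 => (a1 \ot b1) \ot (a2 \ot b2)) b) a))
    (tlift (fun a b => counit a * counit b : k^o))
    (tlift (fun a b => antipode a \ot antipode b)).

Definition base_hopf : hopf_data k :=
  @HopfData k k^o (fun a b => a * b) (1 : k^o)
    (fun a => (a : k) *: ((1 : k^o) \ot (1 : k^o))) id id.

Definition big_tensor (n : nat) (Hs : 'I_n -> hopf_data k) : hopf_data k :=
  foldr tensor_hopf base_hopf [seq Hs i | i <- enum 'I_n].

Definition dual_bas (V : vectType k) (i : 'I_(\dim {:V})) : 'Hom(V, k^o) :=
  linfun (fun v : V => coord (vbasis {:V}) i v : k^o).

(* The comultiplication of a functional f is the element of H^* (x) H^*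
   corresponding to the bilinear form (x, y) |-> f (x y). *)
Definition dual_hopf (H : hopf_data k) : hopf_data k :=
  @HopfData k 'Hom(H, k^o)
    (fun f g => linfun (sw2 (fun h1 h2 => f h1 * g h2 : k^o)))
    (linfun (@counit k H))
    (fun f => \sum_i \sum_j f (hmul (bas i) (bas j)) *: (dual_bas i \ot dual_bas j))
    (fun f => f (hone H))
    (fun f => linfun (fun h => f (antipode h))).

Lemma dual_comulE (H : hopf_data k) (f : dual_hopf H) (x y : H) : is_hopf H ->
  sw2 (fun f1 f2 : dual_hopf H =>
    (f1 : 'Hom(H, k^o)) x * (f2 : 'Hom(H, k^o)) y : k^o) f =
  (f : 'Hom(H, k^o)) (hmul x y).
Proof.
move=> hH; rewrite /sw2 /=.
set b := fun f1 f2 : dual_hopf H => _.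
have hb : bilin b.
  by split=> [u c v v'|u c v v'] /=; rewrite /b lfunE /= lfunE /=
     ?mulrDr ?mulrDl -?scalerAr -?scalerAl.
rewrite [in RHS](coord_bas x) [in RHS](coord_bas y) (bilin_sum _ _ _ _ _ _ (hmul_bilin hH)).
have lt := tlift_linear b.
pose L := GRing.isLinear.Build _ _ _ _ (tlift b) lt.
pose F : {linear _ -> _} := HB.pack (tlift b) L.
rewrite -[tlift b]/(F : _ -> _) !linear_sum; apply: eq_bigr => i _.
rewrite !linear_sum; apply: eq_bigr => j _.
rewrite !linearZ /= tlift_pure // /b /dual_bas !lfunE /=.
by rewrite [LHS]mulrC.
Qed.

Definition delta (I : finType) (i : I) : {ffun I -> k^o} :=
  [ffun j => (j == i)%:R].

Definition group_hopf (gT : finGroupType) : hopf_data k :=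
  @HopfData k {ffun gT -> k^o}
    (fun u v => \sum_g \sum_h (u g * v h) *: delta (g * h)%g)
    (delta 1%g)
    (fun u => \sum_g u g *: (delta g \ot delta g))
    (fun u => \sum_g u g)
    (fun u => \sum_g u g *: delta g^-1%g).

Definition is_trivial (H : hopf_data k) : Prop :=
  exists gT : finGroupType,
    hopf_iso H (group_hopf gT) \/ hopf_iso H (dual_hopf (group_hopf gT)).

(* < a -> f <- b, c > = < f, b c a > *)
Definition hit (H : hopf_data k) (a : H) (f : dual_hopf H) (b : H) : dual_hopf H :=
  linfun (fun c : H => (f : 'Hom(H, k^o)) (hmul (hmul b c) a)).

Definition antipode_inv (H : hopf_data k) : H -> H :=
  ((linfun (@antipode k H))^-1)%VF.

Definition drinfeld_mul (H : hopf_data k)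
    (z w : tensor (dual_hopf H) H) : tensor (dual_hopf H) H :=
  tlift (fun f h => tlift (fun g l =>
    sw3 (fun h1 h2 h3 =>
      hmul f (hit h1 g (antipode_inv h3)) \ot hmul h2 l) h) w) z.

(* The antipode is the one forced by the multiplication and the
   comultiplication: S (f (x) h) = S h . (f o S^-1). *)
Definition drinfeld_double (H : hopf_data k) : hopf_data k :=
  @HopfData k (tensor (dual_hopf H) H)
    (@drinfeld_mul H)
    (hone (dual_hopf H) \ot hone H)
    (tlift (fun f h =>
       sw2 (fun f1 f2 => sw2 (fun h1 h2 => (f2 \ot h1) \ot (f1 \ot h2)) h) f))
    (tlift (fun f h => counit f * counit h : k^o))
    (tlift (fun f h =>
       drinfeld_mul (hone (dual_hopf H) \ot antipode h)
         ((linfun (fun c : H => (f : 'Hom(H, k^o)) (antipode_inv c))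
            : dual_hopf H) \ot hone H))).

Definition is_drinfeld_double (H : hopf_data k) : Prop :=
  exists2 H0 : hopf_data k, is_hopf H0 & hopf_iso H (drinfeld_double H0).

(* The quotient D/I is realized on a linear complement of I, the canonical
   projection [quot_proj] being the projection along I. *)
Definition quot_proj (V : vectType k) (I : {vspace V}) (v : V) : subvs_of (I^C)%VS :=
  vsproj (I^C)%VS (daddv_pi (I^C)%VS I v).

Lemma quot_projK (V : vectType k) (I : {vspace V}) (x : subvs_of (I^C)%VS) :
  quot_proj I (vsval x) = x.
Proof.
by rewrite /quot_proj daddv_pi_id ?subvsP ?vsvalK // capvC capv_compl.
Qed.

Lemma quot_proj_eq0 (V : vectType k) (I : {vspace V}) (v : V) :
  (quot_proj I v == 0) = (v \in I).
Proof.
have dI : (I^C :&: I)%VS = 0%VS by rewrite capvC capv_compl.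
have vE : daddv_pi (I^C) I v + daddv_pi I (I^C) v = v.
  by rewrite daddv_pi_add // addvC addv_complf memvf.
apply/eqP/idP => [|vI].
  move/(congr1 vsval); rewrite vsprojK ?memv_pi //= => v0.
  by rewrite -vE v0 add0r memv_pi.
rewrite /quot_proj (_ : daddv_pi _ _ _ = 0) ?linear0 //.
by apply/eqP; rewrite -memv0 -dI memv_cap memv_pi /= -[X in X \in _](addrK (daddv_pi I (I^C) v)) vE rpredB ?memv_pi.
Qed.

Definition quot_hopf (D : hopf_data k) (I : {vspace D}) : hopf_data k :=
  @HopfData k (subvs_of (I^C)%VS)
    (fun x y => quot_proj I (hmul (vsval x) (vsval y)))
    (quot_proj I (hone D))
    (fun x => sw2 (fun d1 d2 => quot_proj I d1 \ot quot_proj I d2) (vsval x))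
    (fun x => counit (vsval x))
    (fun x => quot_proj I (antipode (vsval x))).

Definition hexp (H : hopf_data k) (z : H) (n : nat) : H :=
  iter n (hmul z) (hone H).

(* For z of order dividing n: the kernel of the counit on the span of the
   powers of z. *)
Definition aug_cyclic (H : hopf_data k) (z : H) (n : nat) : {vspace H} :=
  (<<[seq hexp z i | i <- iota 0 n]>> :&: lker (linfun (@counit k H)))%VS.

Definition left_ideal_gen (H : hopf_data k) (W : {vspace H}) : {vspace H} :=
  <<[seq hmul d w | d <- vbasis {:H}, w <- vbasis W]>>%VS.

(* Basis e_g # f, g in G and f in F, for a right action [act] of F on G. *)
Definition bismash (gT fT : finGroupType) (act : gT -> fT -> gT) : hopf_data k :=
  @HopfData k {ffun gT * fT -> k^o}
    (fun u v => \sum_(s : gT * fT) \sum_(s' : gT * fT)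
       if act s.1 s.2 == s'.1 then (u s * v s') *: delta (s.1, (s.2 * s'.2)%g)
       else 0)
    (\sum_g delta (g, 1%g))
    (fun u => \sum_(s : gT * fT) u s *:
       \sum_(r : gT * gT | (r.1 * r.2)%g == s.1)
         (delta (r.1, s.2) \ot delta (r.2, s.2)))
    (fun u => \sum_f u (1%g, f))
    (fun u => \sum_(s : gT * fT) u s *: delta ((act s.1 s.2)^-1%g, s.2^-1%g)).

End Hopf.

(* < a, b | a^p = b^q = 1, b a b^-1 = a^t >, the pair (i, j) standing for
   a^i b^j; see [mc_relations] and [mc_abX]. *)
Section Metacyclic.
Variables (p q t : nat).
Hypotheses (hp : prime p) (hq : prime q) (ht : t ^ q = 1 %[mod p]).

Definition metacyclic of prime p & prime q & t ^ q = 1 %[mod p] : predArgType :=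
  ('Z_p * 'Z_q)%type.

Local Notation G := (metacyclic hp hq ht).

HB.instance Definition _ := Finite.on G.

Lemma mc_tq : (t%:R : 'Z_p) ^+ q = 1.
Proof.
have p1 := prime_gt1 hp.
by rewrite -natrX -(Zp_nat_mod p1) ht Zp_nat_mod.
Qed.

Lemma mc_texp (j l : 'Z_q) :
  (t%:R : 'Z_p) ^+ (j + l)%R = t%:R ^+ j * t%:R ^+ l.
Proof.
have q1 := prime_gt1 hq.
rewrite -exprD [in RHS](divn_eq (j + l) q) exprD mulnC exprM mc_tq expr1n mul1r.
congr (_ ^+ _); exact: (congr1 (modn (j + l)) (Zp_cast q1)).
Qed.

Definition mc_mul (x y : G) : G := (x.1 + t%:R ^+ x.2 * y.1, x.2 + y.2).
Definition mc_one : G := (0, 0).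
Definition mc_inv (x : G) : G := (- (t%:R ^+ (- x.2)%R * x.1), - x.2).

Lemma mc_mulA : associative mc_mul.
Proof.
move=> [x1 x2] [y1 y2] [z1 z2]; rewrite /mc_mul /=; congr (_, _).
  by rewrite mc_texp mulrDr mulrA addrA.
by rewrite addrA.
Qed.

Lemma mc_mul1 : left_id mc_one mc_mul.
Proof. by move=> [x1 x2]; rewrite /mc_mul /= !add0r expr0 mul1r. Qed.

Lemma mc_mulV : left_inverse mc_one mc_inv mc_mul.
Proof. by move=> [x1 x2]; rewrite /mc_mul /mc_inv /= !addNr. Qed.

HB.instance Definition _ := Finite_isGroup.Build G mc_mulA mc_mul1 mc_mulV.

Definition mc_a : G := (1, 0).
Definition mc_b : G := (0, 1).

(* The right action of F = < x | x^q = 1 >, written additively as 'Z_q: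
   a^i b^j <| x^l = a^(t^l i) b^j. *)
Definition mc_act (g : G) (l : 'Z_q) : G := (t%:R ^+ l * g.1, g.2).

Lemma mc_mulE (x y : G) : (x * y)%g = mc_mul x y. Proof. by []. Qed.

Lemma mc_aX n : (mc_a ^+ n)%g = (n%:R, 0) :> G.
Proof.
elim: n => [|n IHn] //; rewrite expgS IHn mc_mulE /mc_mul /= expr0 mul1r addr0.
by rewrite -natr1 addrC.
Qed.

Lemma mc_bX n : (mc_b ^+ n)%g = (0, n%:R) :> G.
Proof.
elim: n => [|n IHn] //; rewrite expgS IHn mc_mulE /mc_mul /= mulr0 addr0.
by rewrite -natr1 addrC.
Qed.

Lemma mc_abX (g : G) : g = (mc_a ^+ g.1 * mc_b ^+ g.2)%g.
Proof.
case: g => i j; rewrite mc_aX mc_bX mc_mulE /mc_mul /= mulr0 addr0 add0r.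
by rewrite !natr_Zp.
Qed.

Lemma mc_relations :
  [/\ (mc_a ^+ p = 1)%g, (mc_b ^+ q = 1)%g,
      (mc_b * mc_a * mc_b^-1 = mc_a ^+ t)%g & #|{: G}| = (p * q)%N].
Proof.
have [p1 q1] := (prime_gt1 hp, prime_gt1 hq).
split; last by rewrite card_prod !card_ord !Zp_cast.
- by rewrite mc_aX pchar_Zp.
- by rewrite mc_bX pchar_Zp.
apply: (@mulIg _ mc_b); rewrite mulgKV mc_aX !mc_mulE /mc_mul /= /mc_b.
by rewrite modn_small // expr1 mulr1 !add0r mulr0 !addr0.
Qed.

End Metacyclic.

Section Apq.
Variable k : fieldType.
Variables (p q t : nat).
Hypotheses (hp : prime p) (hq : prime q) (ht : t ^ q = 1 %[mod p]).
Variable w : k.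

Definition A0 : hopf_data k := bismash k (@mc_act p q t hp hq ht).

(* The algebra map with chi (e_g) = delta_(g, b) and chi (x) = w. *)
Definition A0_chi : dual_hopf A0 :=
  linfun (fun u : A0 => \sum_(l : 'Z_q)
    (u : {ffun metacyclic hp hq ht * 'Z_q -> k^o}) (mc_b hp hq ht, l) * w ^+ l : k^o).

Definition A0_x : A0 :=
  \sum_(g : metacyclic hp hq ht) delta k (g, 1 : 'Z_q).

Definition chi_x : drinfeld_double A0 := A0_chi \ot A0_x.

Definition Apq : hopf_data k :=
  quot_hopf (left_ideal_gen (aug_cyclic chi_x q)).

End Apq.

(* Main.v *)
From HB Require Import structures.
Require Import Defs.
From mathcomp Require Import all_boot all_order all_algebra all_fingroup all_field.
From mathcomp Require Import pgroup center mxrepresentation.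

Set Implicit Arguments.
Unset Strict Implicit.
Unset Printing Implicit Defensive.

Import GRing.Theory.
Local Open Scope ring_scope.

(** Dimension alone forces a factor of a very special kind. The Hopf algebra
    A(p,q) has dimension p^2 q^3, which is not a square, whereas every double
    has dimension a square; so a decomposition must contain a group algebra or
    the dual of one for a nontrivial group. The proof shows that A(p,q) has no
    such tensor factor.

    Consider the following three properties of a Hopf algebra H, recorded in
    [no_abelian_factor]: the group-like elements of H commute with each other;
    the characters of H (algebra maps H -> k) commute for the convolution; and
    phi z = 1 whenever z is a central group-like element and phi is a character
    which is central in H^*. They pass to tensor factors
    ([big_tensor_no_abelian_factor]): x |-> x (x) 1 and phi |-> phi (x) eps
    preserve group-like elements, characters and both kinds of centrality. For
    H = k[Gamma] the first property says that Gamma is abelian, and for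
    H = k^Gamma the second one does. When Gamma is abelian all its elements are
    central and all its linear characters are cocentral, so the third property
    says that every linear character of Gamma is trivial; over an algebraically
    closed field of characteristic zero this forces Gamma = 1
    ([trivial_no_abelian_factor_dim]).

    It remains to see that A(p,q) has these properties. The point is that F
    acts on G by inner automorphisms: g <| x^l = b^l g b^-l. In the basis
    E_{s,l} (x) e_g # x^m of D(A_0), where E_{s,l} is dual to e_s # x^l, all
    structure maps are monomial ([BB_mul], [sdouble_sw2]), and
    multiplication by the central group-like element chi x raises m by one.
    Hence every class modulo I has a unique representative in the span of the
    elements with m = 0, which is a Hopf subalgebra of D(A_0). This
    identifies A(p,q) with an explicit Hopf algebra [model] with basis
    [s, l, g], for s, g in G and l mod q ([quot_model]).

    In the model a group-like element is a pair consisting of an element s of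
    the centralizer of b, which is <b>, and of a linear character of F x G; a
    character is supported on a single pair (l, g) with g = b^l, on which it is
    given by a linear character of G. Both form abelian groups. A central
    group-like element has s central in G, hence s = 1, and a character that is
    central in the dual has b^l central in G, hence l = 0 and g = 1; such a
    character takes the value 1 on such an element. *)

(** * Linear and bilinear maps *)

(** The structure maps of a [hopf_data] are bare functions for which linearity
    is a proposition; the rules below are the usual ones in this form. *)
Section LinearMaps.
Variable k : fieldType.

Lemma raw_lin0 (V W : lmodType k) (f : V -> W) : linear f -> f 0 = 0.
Proof. by move=> lf; have := lf (-1) 0 0; rewrite scaler0 addr0 scaleN1r addNr. Qed.

Lemma raw_linZ (V W : lmodType k) (f : V -> W) c x : linear f -> f (c *: x) = c *: f x.
Proof. by move=> lf; have := lf c x 0; rewrite (raw_lin0 lf) !addr0. Qed.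

Lemma raw_linD (V W : lmodType k) (f : V -> W) x y : linear f -> f (x + y) = f x + f y.
Proof. by move=> lf; have := lf 1 x y; rewrite !scale1r. Qed.

Lemma raw_lin_sum (V W : lmodType k) (f : V -> W) I (r : seq I) (P : pred I) F : linear f ->
  f (\sum_(i <- r | P i) F i) = \sum_(i <- r | P i) f (F i).
Proof.
move=> lf; apply: (big_morph f) => [x y|]; [exact: raw_linD | exact: raw_lin0].
Qed.

Lemma raw_linfunE (V W : vectType k) (f : V -> W) : linear f -> linfun f =1 f.
Proof.
move=> lf x; pose L := GRing.isLinear.Build _ _ _ _ f lf.
by pose F : {linear V -> W} := HB.pack f L; rewrite -[f]/(F : _ -> _) lfunE.
Qed.

Lemma linfun_linear (V W : vectType k) (f : 'Hom(V, W)) : linear f.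
Proof. by move=> c x y; rewrite linearP. Qed.

Lemma linear_id (V : lmodType k) : linear (fun x : V => x).
Proof. by []. Qed.

Lemma linear_comp (U V W : lmodType k) (f : V -> W) (g : U -> V) :
  linear f -> linear g -> linear (fun x => f (g x)).
Proof. by move=> lf lg c x y; rewrite lg lf. Qed.

Lemma bilin_l (U V W : vectType k) (b : U -> V -> W) w : bilin b -> linear (b^~ w).
Proof. by case. Qed.

Lemma bilin_r (U V W : vectType k) (b : U -> V -> W) v : bilin b -> linear (b v).
Proof. by case. Qed.

Section BilinRules.
Variables (U V W : vectType k) (b : U -> V -> W) (hb : bilin b).

Lemma bilin_Zl c u v : b (c *: u) v = c *: b u v.
Proof. exact: (raw_linZ c u (bilin_l v hb)). Qed.

Lemma bilin_Zr c u v : b u (c *: v) = c *: b u v.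
Proof. exact: (raw_linZ c v (bilin_r u hb)). Qed.

Lemma bilin_suml I (r : seq I) (P : pred I) F v :
  b (\sum_(i <- r | P i) F i) v = \sum_(i <- r | P i) b (F i) v.
Proof. exact: (raw_lin_sum r P F (bilin_l v hb)). Qed.

Lemma bilin_sumr I (r : seq I) (P : pred I) F u :
  b u (\sum_(i <- r | P i) F i) = \sum_(i <- r | P i) b u (F i).
Proof. exact: (raw_lin_sum r P F (bilin_r u hb)). Qed.

Lemma bilin_0l v : b 0 v = 0.
Proof. exact: (raw_lin0 (bilin_l v hb)). Qed.

Lemma bilin_0r u : b u 0 = 0.
Proof. exact: (raw_lin0 (bilin_r u hb)). Qed.

End BilinRules.

Lemma bilin_comp (U V W V' W' : vectType k) (b : V -> W -> U) (f : V' -> V) (g : W' -> W) :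
  bilin b -> linear f -> linear g -> bilin (fun v w => b (f v) (g w)).
Proof.
move=> [br bl] lf lg; split=> [v|w] c x y; first by rewrite lg br.
by rewrite lf; have /= -> := bl (g w) c (f x) (f y).
Qed.

Lemma bilin_scale (V W : vectType k) (f : V -> k^o) :
  linear f -> bilin (fun v (w : W) => f v *: w).
Proof.
move=> lf; split=> [v|w] c x y; first by rewrite scalerDr !scalerA mulrC.
by rewrite lf scalerDl scalerA.
Qed.

Lemma bilin_scale_flip (V W : vectType k) (f : W -> k^o) :
  linear f -> bilin (fun (v : V) w => f w *: v).
Proof. by move/(bilin_scale V) => [? ?]; split. Qed.

Lemma bilin_mul (V W : vectType k) (f : V -> k^o) (g : W -> k^o) :
  linear f -> linear g -> bilin (fun v w => f v * g w : k^o).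
Proof. by move=> lf lg; apply: (bilin_comp (bilin_scale _ lf) (@linear_id _) lg). Qed.

Lemma tlift_comp (V W U U' : vectType k) (b : V -> W -> U) (f : U -> U') z :
  linear f -> f (tlift b z) = tlift (fun v w => f (b v w)) z.
Proof.
move=> lf; rewrite /tlift raw_lin_sum //; apply: eq_bigr => i _.
by rewrite raw_lin_sum //; apply: eq_bigr => j _; rewrite raw_linZ.
Qed.

Lemma eq_tlift (V W U : vectType k) (b c : V -> W -> U) z :
  (forall v w, b v w = c v w) -> tlift b z = tlift c z.
Proof. by move=> e; apply: eq_bigr => i _; apply: eq_bigr => j _; rewrite e. Qed.

Lemma tlift_param_linear (X V W U : vectType k) (b : X -> V -> W -> U) z :
  (forall v w, linear (fun x => b x v w)) -> linear (fun x => tlift (b x) z).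
Proof.
move=> lb c x y; rewrite /tlift scaler_sumr -big_split; apply: eq_bigr => i _.
rewrite scaler_sumr -big_split; apply: eq_bigr => j _ /=.
by rewrite lb scalerDr !scalerA mulrC.
Qed.

Lemma tlift_map (V W V' W' U : vectType k) (b : V' -> W' -> U) (f : V -> V') (g : W -> W') z :
  bilin b -> tlift b (tlift (fun v w => f v \ot g w) z) = tlift (fun v w => b (f v) (g w)) z.
Proof.
move=> hb; rewrite (tlift_comp _ _ (tlift_linear b)).
by apply: eq_tlift => v w; rewrite tlift_pure.
Qed.

Lemma sw2_linear (H : hopf_data k) (U : vectType k) (b : H -> H -> U) :
  linear (@comul k H) -> linear (sw2 b).
Proof. by move=> lc; apply: linear_comp lc; apply: tlift_linear. Qed.

Lemma sw2_comp (H : hopf_data k) (U U' : vectType k) (b : H -> H -> U) (f : U -> U') x :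
  linear f -> f (sw2 b x) = sw2 (fun x1 x2 => f (b x1 x2)) x.
Proof. exact: tlift_comp. Qed.

Lemma sw2_pure (H : hopf_data k) (x : H) : sw2 (fun x1 x2 => x1 \ot x2) x = comul x.
Proof. by rewrite /sw2 -tensor_sum. Qed.

Lemma tensor_ext (V W U : vectType k) (f g : tensor V W -> U) : linear f -> linear g ->
  (forall v w, f (v \ot w) = g (v \ot w)) -> forall z, f z = g z.
Proof. exact: tlift_uniq. Qed.

End LinearMaps.

(** * Abelian factors *)

Section Factors.
Variable k : fieldType.
Implicit Types H X T : hopf_data k.

Definition grouplike H (z : H) := comul z = z \ot z /\ counit z = 1.

Definition character H (phi : H -> k^o) :=
  [/\ linear phi, phi (hone H) = 1 & forall x y, phi (hmul x y) = phi x * phi y].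

Definition central H (z : H) := forall x, hmul z x = hmul x z.

Definition cocentral H (phi : H -> k^o) := forall x : H,
  sw2 (fun x1 x2 => phi x1 *: x2) x = sw2 (fun x1 x2 => phi x2 *: x1) x.

Definition convol H (phi psi : H -> k^o) (x : H) : k^o :=
  sw2 (fun x1 x2 => phi x1 * psi x2 : k^o) x.

(** If k[A] is a tensor factor of H for a finite abelian group A, then an
    element of A and a linear character of A give a central group-like element
    of H and a cocentral character of H, with the original pairing. So the
    third clause excludes such factors when A has a nontrivial linear character;
    the first two make every group that occurs in a trivial factor abelian. *)
Record no_abelian_factor H : Prop := NoAbelianFactor {
  grouplikes_commute : forall y z : H, grouplike y -> grouplike z -> hmul y z = hmul z y;
  characters_commute : forall phi psi : H -> k^o,
    character phi -> character psi -> convol phi psi =1 convol psi phi;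
  pairing_trivial : forall (z : H) (phi : H -> k^o),
    grouplike z -> central z -> character phi -> cocentral phi -> phi z = 1 }.

(** What is common to the embedding of a tensor factor, with the projection
    onto it by the counits of the other factors, and to an isomorphism with its
    inverse: enough to transport group-like elements along [i], and characters
    along [r], together with their centrality conditions. *)

Record biretract X T (i : X -> T) (r : T -> X) : Prop := Biretract {
  biret_i_linear : linear i;
  biret_r_linear : linear r;
  biret_id : cancel i r;
  biret_i_mul : forall x y, i (hmul x y) = hmul (i x) (i y);
  biret_i_comul : forall x, comul (i x) = sw2 (fun x1 x2 => i x1 \ot i x2) x;
  biret_i_counit : forall x, counit (i x) = counit x;
  biret_i_central : forall x, central x -> central (i x);
  biret_r_one : r (hone T) = hone X;
  biret_r_mul : forall x y, r (hmul x y) = hmul (r x) (r y);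
  biret_r_cocentral : forall phi : X -> k^o, linear phi ->
    cocentral phi -> cocentral (fun x => phi (r x)) }.

Lemma biretract_no_abelian_factor X T (i : X -> T) (r : T -> X) :
  biretract i r -> no_abelian_factor T -> no_abelian_factor X.
Proof.
move=> [li lr rK iM iD ie iZ r1 rM rZ] [glC chC pair1].
have gl_i z : grouplike z -> grouplike (i z).
  move=> [Dz ez]; split; last by rewrite ie.
  rewrite iD /sw2 Dz tlift_pure //.
  exact: (bilin_comp (pure_bilin _ _) li li).
have ch_r phi : character phi -> character (fun x => phi (r x)).
  move=> [lphi phi1 phiM]; split=> [||x y]; first exact: linear_comp.
    by rewrite r1.
  by rewrite rM phiM.
split=> [y z gy gz|phi psi cphi cpsi x|z phi gz Zz cphi Zphi].
- by rewrite -[hmul y z]rK -[hmul z y]rK !iM glC //; apply: gl_i.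
- have conv_r (f g : X -> k^o) : character f -> character g ->
      convol (fun x => f (r x)) (fun x => g (r x)) (i x) = convol f g x.
    case=> lf _ _ [lg _ _]; rewrite /convol /sw2 iD tlift_map; last first.
      by apply: bilin_mul; apply: linear_comp.
    by apply: eq_tlift => u v; rewrite !rK.
  by rewrite -!conv_r // chC //; apply: ch_r.
- rewrite -[z]rK (pair1 (i z) (fun x => phi (r x))) //; [exact: gl_i|exact: iZ|exact: ch_r|].
  by case: cphi => lphi _ _; apply: rZ.
Qed.

Lemma hopf_iso_biretract X T (f : 'Hom(T, X)) (g : X -> T) :
  hopf_morphism f -> cancel f g -> cancel g f -> biretract g f.
Proof.
move=> [fM f1 fD fe] fK gK.
have lf := linfun_linear f.
have lg : linear g by move=> c x y; apply: (can_inj fK); rewrite lf !gK.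
have gM x y : g (hmul x y) = hmul (g x) (g y).
  by apply: (can_inj fK); rewrite fM !gK.
have gD x : comul (g x) = sw2 (fun x1 x2 => g x1 \ot g x2) x.
  rewrite -{2}[x]gK /sw2 fD tlift_map; last exact: (bilin_comp (pure_bilin _ _) lg lg).
  by rewrite [LHS]tensor_sum; apply: eq_tlift => u v; rewrite !fK.
split=> // [x|x Zx y|phi lphi Zphi x].
- by rewrite -fe gK.
- by rewrite -[y]fK -!gM Zx.
- apply: (can_inj fK); rewrite !(sw2_comp _ _ lf).
  have := Zphi (f x); rewrite /sw2 fD !tlift_map => [e||].
  + rewrite -[LHS]/(tlift _ _) (_ : tlift _ _ = tlift (fun v w => phi (f v) *: f w) (comul x)).
      by rewrite e; apply: eq_tlift => u v; rewrite linearZ.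
    by apply: eq_tlift => u v; rewrite linearZ.
  + exact: bilin_scale_flip.
  + exact: bilin_scale.
Qed.

Lemma hopf_iso_sym X T : hopf_iso X T -> hopf_iso T X.
Proof.
move=> [f mf [g fK gK]]; have br := hopf_iso_biretract mf fK gK.
have gE := raw_linfunE (biret_i_linear br).
exists (linfun g); last by exists f => x; rewrite gE.
split=> [x y||x|x]; rewrite !gE.
- exact: (biret_i_mul br).
- by rewrite -(morph_hone mf) fK.
- by rewrite (biret_i_comul br); apply: eq_tlift => u v; rewrite !gE.
- exact: (biret_i_counit br).
Qed.

Lemma hopf_iso_no_abelian_factor X T :
  hopf_iso X T -> no_abelian_factor X -> no_abelian_factor T.
Proof.
move=> [f mf [g fK gK]].
exact: biretract_no_abelian_factor (hopf_iso_biretract mf fK gK).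
Qed.

Lemma hopf_iso_dim X T : hopf_iso X T -> \dim {: X} = \dim {: T}.
Proof.
move=> [f _ [g fK gK]]; rewrite -(limg_dim_eq (f := f) (U := fullv)).
  congr (\dim _); apply/vspaceP=> y; rewrite memvf.
  by rewrite -[y]gK memv_img ?memvf.
apply/eqP; rewrite capfv -subv0; apply/subvP=> x; rewrite memv_ker memv0 => /eqP fx0.
by rewrite -[x]fK fx0 -(linear0 f) fK.
Qed.

End Factors.

(** * Tensor products of Hopf algebras *)

Section TensorHopf.
Variable k : fieldType.
Implicit Types A B : hopf_data k.

(** The unit embeds a factor into a tensor product and the counit projects onto
    it; these axioms make both maps compatible with the structure, and they
    pass to tensor products by evaluation on pure tensors. *)
Record unital_counital A : Prop := UnitalCounital {
  uc_mul_bilin : bilin (@hmul k A);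
  uc_comul_linear : linear (@comul k A);
  uc_counit_linear : linear (@counit k A);
  uc_mul1l : left_id (hone A) (@hmul k A);
  uc_mul1r : right_id (hone A) (@hmul k A);
  uc_counit1l : forall h : A, sw2 (fun h1 h2 : A => counit h1 *: h2) h = h;
  uc_counit1r : forall h : A, sw2 (fun h1 h2 : A => counit h2 *: h1) h = h;
  uc_comul1 : comul (hone A) = hone A \ot hone A;
  uc_counitM : forall g h : A, counit (hmul g h) = counit g * counit h;
  uc_counit1 : counit (hone A) = 1 }.

Lemma is_hopf_unital_counital A : is_hopf A -> unital_counital A.
Proof. by case. Qed.

Lemma base_unital_counital : unital_counital (base_hopf k).
Proof.
have lin_scal c : linear (fun x : k^o => c *: x) by move=> a x y; rewrite linearP.
have bmul : bilin (@hmul k (base_hopf k)).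
  exact: (bilin_mul (@linear_id _ _) (@linear_id _ _)).
have lcomul : linear (@comul k (base_hopf k)).
  by move=> c x y /=; rewrite scalerDl scalerA.
split=> //=; [exact: mul1r|exact: mulr1| | |exact: scale1r]; move=> h; rewrite /sw2 /=.
  rewrite (raw_linZ _ _ (tlift_linear _)) tlift_pure; last exact: bilin_scale.
  by rewrite scale1r [LHS]mulr1.
rewrite (raw_linZ _ _ (tlift_linear _)) tlift_pure; last exact: bilin_scale_flip.
by rewrite scale1r [LHS]mulr1.
Qed.

Section Two.
Variables A B : hopf_data k.
Hypotheses (ucA : unital_counital A) (ucB : unital_counital B).
Let T := tensor_hopf A B.

Lemma tensor_hmul_bilin : bilin (@hmul k T).
Proof.
split=> [z|w] c x y /=; last exact: tlift_linear.
apply: (@tlift_param_linear _ (tensor A B) A B _ (fun w a b => tlift _ w)) => a b.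
exact: tlift_linear.
Qed.

Lemma tensor_hmulE (a a' : A) (b b' : B) :
  hmul (a \ot b : T) (a' \ot b') = hmul a a' \ot hmul b b'.
Proof.
have pb := pure_bilin A B; have [mA mB] := (uc_mul_bilin ucA, uc_mul_bilin ucB).
have bi a1 b1 : bilin (fun (a2 : A) (b2 : B) => hmul a1 a2 \ot hmul b1 b2).
  by apply: (bilin_comp pb); apply: bilin_r.
rewrite /= tlift_pure ?tlift_pure //.
split=> [a1|b1].
  apply: (@tlift_param_linear _ B A B _ (fun b1 a2 b2 => hmul a1 a2 \ot hmul b1 b2)) => a2 b2.
  by apply: linear_comp; [apply: bilin_r|apply: (bilin_l _ mB)].
apply: (@tlift_param_linear _ A A B _ (fun a1 a2 b2 => hmul a1 a2 \ot hmul b1 b2)) => a2 b2.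
by apply: (linear_comp (bilin_l (hmul b1 b2) pb)); apply: (bilin_l _ mA).
Qed.

Lemma tensor_comul_linear : linear (@comul k T).
Proof. exact: tlift_linear. Qed.

(** The coproduct of [a \ot b] is computed one factor at a time; all statements
    about the comultiplication of a tensor product are reduced to it. *)
Lemma tensor_sw2E (U : vectType k) (c : T -> T -> U) (a : A) (b : B) : bilin c ->
  sw2 c (a \ot b : T) =
  sw2 (fun a1 a2 => sw2 (fun b1 b2 => c (a1 \ot b1) (a2 \ot b2)) b) a.
Proof.
have [pb pbT] := (pure_bilin A B, pure_bilin (tensor A B) (tensor A B)).
have [cA cB] := (uc_comul_linear ucA, uc_comul_linear ucB).
move=> bc; rewrite {1}/sw2 /= tlift_pure.
  rewrite (sw2_comp _ _ (tlift_linear c)); apply: eq_tlift => a1 a2.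
  rewrite (sw2_comp _ _ (tlift_linear c)); apply: eq_tlift => b1 b2.
  by rewrite tlift_pure.
split=> [a0|b0]; last exact: sw2_linear.
apply: (@tlift_param_linear _ B A A _ (fun b0 a1 a2 =>
  sw2 (fun b1 b2 => (a1 \ot b1) \ot (a2 \ot b2)) b0)) => a1 a2.
exact: sw2_linear.
Qed.

Lemma tensor_counitE (a : A) (b : B) : counit (a \ot b : T) = counit a * counit b.
Proof. by rewrite /= tlift_pure //; apply: bilin_mul; [case: ucA | case: ucB]. Qed.

Lemma tensor_counit_linear : linear (@counit k T).
Proof. exact: tlift_linear. Qed.

Lemma tensor_unital_counital : unital_counital T.
Proof.
have pb := pure_bilin A B; have pbT := pure_bilin (tensor A B) (tensor A B).
have mT := tensor_hmul_bilin; have cT := tensor_comul_linear.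
have eT := tensor_counit_linear.
have [mA cA eA m1A m1rA e1A e1rA D1A eMA e1] := ucA.
have [mB cB eB m1B m1rB e1B e1rB D1B eMB e1'] := ucB.
split=> //.
- apply: tensor_ext => [|//|a b]; first exact: bilin_r.
  by rewrite [hone _]/= tensor_hmulE m1A m1B.
- apply: tensor_ext => [|//|a b]; first exact: (bilin_l _ mT).
  by rewrite [hone _]/= tensor_hmulE m1rA m1rB.
- apply: tensor_ext => [|//|a b]; first exact: (sw2_linear _ cT).
  rewrite tensor_sw2E; last exact: bilin_scale.
  have l1 (a' : A) : linear (fun b' : B => a' \ot b') by apply: bilin_r.
  rewrite -{2}(e1A a) -{2}(e1B b).
  rewrite (sw2_comp _ _ (bilin_l _ pb)); apply: eq_tlift => a1 a2.
  rewrite (sw2_comp _ _ (bilin_r _ pb)); apply: eq_tlift => b1 b2.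
  rewrite tensor_counitE (raw_linZ _ _ (bilin_r _ pb)).
  by rewrite [in RHS](raw_linZ _ _ (bilin_l _ pb)) scalerA mulrC.
- apply: tensor_ext => [|//|a b]; first exact: (sw2_linear _ cT).
  rewrite tensor_sw2E; last exact: bilin_scale_flip.
  rewrite -{2}(e1rA a) -{2}(e1rB b).
  rewrite (sw2_comp _ _ (bilin_l _ pb)); apply: eq_tlift => a1 a2.
  rewrite (sw2_comp _ _ (bilin_r _ pb)); apply: eq_tlift => b1 b2.
  rewrite tensor_counitE (raw_linZ _ _ (bilin_r _ pb)).
  by rewrite [in RHS](raw_linZ _ _ (bilin_l _ pb)) scalerA mulrC.
- rewrite -sw2_pure tensor_sw2E // /sw2 D1A tlift_pure ?D1B ?tlift_pure //.
    by apply: (bilin_comp pbT); apply: bilin_r.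
  split=> [v|v]; apply: (tlift_param_linear (X := A)) => b1 b2.
    by apply: (linear_comp (bilin_r _ pbT)); apply: (bilin_l _ pb).
  by apply: (linear_comp (bilin_l _ pbT)); apply: (bilin_l _ pb).
- move=> g; apply: tensor_ext => [||c d].
  + by apply: linear_comp eT _; apply: bilin_r.
  + exact: (bilin_r g (bilin_mul eT eT)).
  move: g; apply: tensor_ext => [||a b].
  + by apply: linear_comp eT _; apply: (bilin_l _ mT).
  + exact: (bilin_l (c \ot d : T) (bilin_mul eT eT)).
  by rewrite tensor_hmulE !tensor_counitE eMA eMB mulrACA.
- by rewrite [hone _]/= tensor_counitE e1 e1' mulr1.
Qed.

Definition tensor_inl (a : A) : T := a \ot hone B.
Definition tensor_prl : T -> A := tlift (fun (a : A) (b : B) => counit b *: a).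
Definition tensor_inr (b : B) : T := hone A \ot b.
Definition tensor_prr : T -> B := tlift (fun (a : A) (b : B) => counit a *: b).

Lemma tensor_prlE a b : tensor_prl (a \ot b) = counit b *: a.
Proof. by rewrite /tensor_prl tlift_pure //; apply: bilin_scale_flip; case: ucB. Qed.

Lemma tensor_prrE a b : tensor_prr (a \ot b) = counit a *: b.
Proof. by rewrite /tensor_prr tlift_pure //; apply: bilin_scale; case: ucA. Qed.

Lemma tensor_inl_biretract : biretract tensor_inl tensor_prl.
Proof.
have pb := pure_bilin A B; have pbT := pure_bilin (tensor A B) (tensor A B).
have mT := tensor_hmul_bilin; have cT := tensor_comul_linear.
have lr : linear tensor_prl by apply: tlift_linear.
have [mA cA eA m1A m1rA e1A e1rA D1A eMA e1] := ucA.
have [mB cB eB m1B m1rB e1B e1rB D1B eMB e1'] := ucB.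
have li : linear tensor_inl by apply: (bilin_l _ pb).
split=> //.
- by move=> a; rewrite tensor_prlE e1' scale1r.
- by move=> x y; rewrite tensor_hmulE m1B.
- move=> x; rewrite -sw2_pure tensor_sw2E //; apply: eq_tlift => a1 a2.
  by rewrite /sw2 D1B tlift_pure //; apply: (bilin_comp pbT); apply: bilin_r.
- by move=> x; rewrite tensor_counitE e1' mulr1.
- move=> x Zx; apply: tensor_ext => [||a b].
  + exact: bilin_r.
  + exact: (bilin_l _ mT).
  + by rewrite !tensor_hmulE m1B m1rB Zx.
- by rewrite [hone _]/= tensor_prlE e1' scale1r.
- move=> z; apply: tensor_ext => [||c d].
  + exact: (linear_comp lr (bilin_r z mT)).
  + exact: (linear_comp (bilin_r _ mA) lr).
  move: z; apply: tensor_ext => [||a b].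
  + exact: (linear_comp lr (bilin_l _ mT)).
  + exact: (linear_comp (bilin_l _ mA) lr).
  rewrite tensor_hmulE !tensor_prlE eMB.
  by rewrite (raw_linZ _ _ (bilin_r _ mA)) (raw_linZ _ _ (bilin_l _ mA)) scalerA mulrC.
- move=> phi lphi Zphi; have lpr := linear_comp lphi lr.
  apply: tensor_ext => [||a b]; try exact: (sw2_linear _ cT).
  rewrite !tensor_sw2E; [|exact: bilin_scale_flip|exact: bilin_scale].
  transitivity (sw2 (fun a1 a2 => phi a1 *: a2) a \ot b).
    rewrite -{2}(e1B b) (sw2_comp _ _ (bilin_l _ pb)); apply: eq_tlift => a1 a2.
    rewrite (sw2_comp _ _ (bilin_r _ pb)); apply: eq_tlift => b1 b2.
    rewrite tensor_prlE (raw_linZ _ _ lphi) (raw_linZ _ _ (bilin_r _ pb)).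
    by rewrite [in RHS](raw_linZ _ _ (bilin_l _ pb)) scalerA.
  rewrite Zphi -{1}(e1rB b) (sw2_comp _ _ (bilin_l _ pb)); apply: eq_tlift => a1 a2.
  rewrite (sw2_comp _ _ (bilin_r _ pb)); apply: eq_tlift => b1 b2.
  rewrite tensor_prlE (raw_linZ _ _ lphi) (raw_linZ _ _ (bilin_r _ pb)).
  by rewrite [in LHS](raw_linZ _ _ (bilin_l _ pb)) scalerA.
Qed.

Lemma tensor_inr_biretract : biretract tensor_inr tensor_prr.
Proof.
have pb := pure_bilin A B; have pbT := pure_bilin (tensor A B) (tensor A B).
have mT := tensor_hmul_bilin; have cT := tensor_comul_linear.
have lr : linear tensor_prr by apply: tlift_linear.
have [mA cA eA m1A m1rA e1A e1rA D1A eMA e1] := ucA.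
have [mB cB eB m1B m1rB e1B e1rB D1B eMB e1'] := ucB.
have li : linear tensor_inr by apply: (bilin_r _ pb).
split=> //.
- by move=> b; rewrite tensor_prrE e1 scale1r.
- by move=> x y; rewrite tensor_hmulE m1A.
- move=> x; rewrite -sw2_pure tensor_sw2E // {1}/sw2 D1A tlift_pure //.
  split=> [v|v]; apply: (@tlift_param_linear _ A B B _ (fun a b1 b2 => _)) => b1 b2.
    by apply: (linear_comp (bilin_r _ pbT)); apply: (bilin_l _ pb).
  by apply: (linear_comp (bilin_l _ pbT)); apply: (bilin_l _ pb).
- by move=> x; rewrite tensor_counitE e1 mul1r.
- move=> x Zx; apply: tensor_ext => [||a b].
  + exact: bilin_r.
  + exact: (bilin_l _ mT).
  + by rewrite !tensor_hmulE m1A m1rA Zx.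
- by rewrite [hone _]/= tensor_prrE e1 scale1r.
- move=> z; apply: tensor_ext => [||c d].
  + exact: (linear_comp lr (bilin_r z mT)).
  + exact: (linear_comp (bilin_r _ mB) lr).
  move: z; apply: tensor_ext => [||a b].
  + exact: (linear_comp lr (bilin_l _ mT)).
  + exact: (linear_comp (bilin_l _ mB) lr).
  rewrite tensor_hmulE !tensor_prrE eMA.
  by rewrite (raw_linZ _ _ (bilin_r _ mB)) (raw_linZ _ _ (bilin_l _ mB)) scalerA mulrC.
- move=> phi lphi Zphi; have lpr := linear_comp lphi lr.
  apply: tensor_ext => [||a b]; try exact: (sw2_linear _ cT).
  rewrite !tensor_sw2E; [|exact: bilin_scale_flip|exact: bilin_scale].
  transitivity (a \ot sw2 (fun b1 b2 => phi b1 *: b2) b).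
    rewrite -{2}(e1A a) (sw2_comp _ _ (bilin_l _ pb)); apply: eq_tlift => a1 a2.
    rewrite (sw2_comp _ _ (bilin_r _ pb)); apply: eq_tlift => b1 b2.
    rewrite tensor_prrE (raw_linZ _ _ lphi) (raw_linZ _ _ (bilin_r _ pb)).
    by rewrite [in RHS](raw_linZ _ _ (bilin_l _ pb)) scalerA mulrC.
  rewrite Zphi -{1}(e1rA a) (sw2_comp _ _ (bilin_l _ pb)); apply: eq_tlift => a1 a2.
  rewrite (sw2_comp _ _ (bilin_r _ pb)); apply: eq_tlift => b1 b2.
  rewrite tensor_prrE (raw_linZ _ _ lphi) (raw_linZ _ _ (bilin_r _ pb)).
  by rewrite [in LHS](raw_linZ _ _ (bilin_l _ pb)) scalerA mulrC.
Qed.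

End Two.

Lemma tensor_dim A B : \dim {: tensor_hopf A B} = (\dim {: A} * \dim {: B})%N.
Proof. by rewrite dimvf /= dim_matrix. Qed.

Lemma foldr_tensor_unital_counital n (Hs : 'I_n -> hopf_data k) (s : seq 'I_n) :
  (forall i, is_hopf (Hs i)) ->
  unital_counital (foldr (@tensor_hopf k) (base_hopf k) [seq Hs i | i <- s]).
Proof.
move=> hHs; elim: s => [|i s IHs] /=; first exact: base_unital_counital.
by apply: tensor_unital_counital => //; apply: is_hopf_unital_counital.
Qed.

Lemma big_tensor_no_abelian_factor n (Hs : 'I_n -> hopf_data k) :
  (forall i, is_hopf (Hs i)) -> no_abelian_factor (big_tensor Hs) ->
  forall i, no_abelian_factor (Hs i).
Proof.
move=> hHs naf i; have := mem_enum 'I_n i; move: naf; rewrite /big_tensor inE.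
elim: (enum _) => [|j s IHs] //= naf.
have ucj := is_hopf_unital_counital (hHs j).
have ucs := foldr_tensor_unital_counital s hHs.
rewrite inE => /orP[/eqP->|].
  exact: biretract_no_abelian_factor (tensor_inl_biretract ucj ucs) naf.
apply: IHs.
exact: biretract_no_abelian_factor (tensor_inr_biretract ucj ucs) naf.
Qed.

Lemma big_tensor_dim n (Hs : 'I_n -> hopf_data k) :
  \dim {: big_tensor Hs} = (\prod_i \dim {: Hs i})%N.
Proof.
rewrite /big_tensor -big_enum /=; elim: (enum _) => [|i s IHs].
  by rewrite big_nil /= dimvf.
by rewrite big_cons /= -IHs tensor_dim.
Qed.

End TensorHopf.

(** * Functions on a finite set and dual bases *)

Section Delta.
Variables (k : fieldType) (I : finType).
Local Notation kI := {ffun I -> k^o}.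

Lemma deltaE (i j : I) : delta k i j = (j == i)%:R.
Proof. by rewrite ffunE. Qed.

Lemma ffun_sumE (J : finType) (P : pred J) (F : J -> kI) i :
  (\sum_(j | P j) F j) i = \sum_(j | P j) F j i.
Proof. by rewrite sum_ffunE. Qed.

Lemma ffun_delta (u : kI) : u = \sum_i u i *: delta k i.
Proof.
apply/ffunP=> j; rewrite ffun_sumE (bigD1 j) //= big1 ?addr0 => [|i nij].
  by rewrite ffunE deltaE eqxx [RHS]mulr1.
by rewrite ffunE deltaE eq_sym (negPf nij) [LHS]mulr0.
Qed.

Lemma delta_ext (W : lmodType k) (f g : kI -> W) : linear f -> linear g ->
  (forall i, f (delta k i) = g (delta k i)) -> f =1 g.
Proof.
move=> lf lg e u; rewrite (ffun_delta u) !raw_lin_sum //; apply: eq_bigr => i _.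
by rewrite !raw_linZ // e.
Qed.

Lemma sum_delta_lin (W : lmodType k) (F : I -> W) i :
  \sum_j delta k i j *: F j = F i.
Proof.
rewrite (bigD1 i) //= deltaE eqxx scale1r big1 ?addr0 // => j nji.
by rewrite deltaE (negPf nji) scale0r.
Qed.

Lemma ext1_linear (W : lmodType k) (F : I -> W) : linear (fun u : kI => \sum_i u i *: F i).
Proof.
move=> c x y; rewrite scaler_sumr -big_split; apply: eq_bigr => i _ /=.
by rewrite !ffunE scalerA -scalerDl.
Qed.

Lemma ext2_bilin (J : finType) (W : vectType k) (F : I -> J -> W) :
  bilin (fun (u : kI) (v : {ffun J -> k^o}) => \sum_i \sum_j (u i * v j) *: F i j).
Proof.
split=> [u|v] c x y /=; rewrite scaler_sumr -big_split; apply: eq_bigr => i _ /=;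
  rewrite scaler_sumr -big_split; apply: eq_bigr => j _ /=;
  rewrite !ffunE scalerA -scalerDl; congr (_ *: _).
  by rewrite mulrDr mulrCA.
by rewrite mulrDl mulrA.
Qed.

Lemma ffun_dim : \dim {: kI} = #|I|.
Proof. by rewrite dimvf /dim /= muln1. Qed.

Definition dual_delta (i : I) : 'Hom(kI, k^o) := linfun (fun u : kI => u i).

Lemma dual_deltaE i (u : kI) : dual_delta i u = u i.
Proof. by rewrite raw_linfunE // => c x y; rewrite !ffunE. Qed.

Lemma dual_ext (f g : 'Hom(kI, k^o)) :
  (forall i, f (delta k i) = g (delta k i)) -> f = g.
Proof. by move=> e; apply/lfunP; apply: delta_ext => //; apply: linfun_linear. Qed.

End Delta.

Lemma ext2_delta (k : fieldType) (I J : finType) (W : lmodType k) (F : I -> J -> W) i j :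
  \sum_i' \sum_j' (delta k i i' * delta k j j') *: F i' j' = F i j.
Proof.
rewrite -[RHS](sum_delta_lin (F^~ j)); apply: eq_bigr => i' _.
rewrite -[in RHS](sum_delta_lin (F i')) scaler_sumr; apply: eq_bigr => j' _.
by rewrite scalerA.
Qed.

Section Dual.
Variables (k : fieldType) (H : hopf_data k).

Lemma dual_hmulE (f g : dual_hopf H) (x : H) : linear (@comul k H) ->
  (hmul f g : 'Hom(H, k^o)) x =
  sw2 (fun x1 x2 => (f : 'Hom(H, k^o)) x1 * (g : 'Hom(H, k^o)) x2 : k^o) x.
Proof. by move=> lD; rewrite /= raw_linfunE //; apply: sw2_linear. Qed.

Lemma dual_honeE (x : H) : linear (@counit k H) ->
  (hone (dual_hopf H) : 'Hom(H, k^o)) x = counit x.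
Proof. by move=> le; rewrite /= raw_linfunE. Qed.

(** [dual_hopf] computes its comultiplication in the dual of
    [vbasis]; any other pair of dual bases gives the same result. *)
Lemma dual_comul_basis (I : finType) (x : I -> H) (X : I -> dual_hopf H) (f : dual_hopf H) :
  bilin (@hmul k H) ->
  (forall h : H, h = \sum_i (X i : 'Hom(H, k^o)) h *: x i) ->
  comul f = \sum_i \sum_j
    (f : 'Hom(H, k^o)) (hmul (x i) (x j)) *: (X i \ot X j).
Proof.
move=> bm xX.
have XE i : X i = \sum_a (X i : 'Hom(H, k^o)) (bas a) *: dual_bas a.
  apply/lfunP=> h; rewrite sum_lfunE [in LHS](coord_bas h) linear_sum /=.
  apply: eq_bigr => a _; rewrite linearZ /= scale_lfunE /dual_bas lfunE /=.
  by rewrite [LHS]mulrC.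
transitivity (\sum_i \sum_j \sum_a \sum_b
    ((f : 'Hom(H, k^o)) (hmul (x i) (x j)) *
     ((X i : 'Hom(H, k^o)) (bas a) * (X j : 'Hom(H, k^o)) (bas b)))
      *: ((dual_bas a : dual_hopf H) \ot (dual_bas b : dual_hopf H))); last first.
  apply: eq_bigr => i _; apply: eq_bigr => j _.
  rewrite {2}(XE i) {2}(XE j) bilin_sum ?scaler_sumr; last exact: pure_bilin.
  apply: eq_bigr => a _; rewrite scaler_sumr; apply: eq_bigr => b _.
  by rewrite scalerA.
under [RHS]eq_bigr => i _ do rewrite exchange_big /=.
rewrite exchange_big /=; apply: eq_bigr => a _.
under [RHS]eq_bigr => i _ do rewrite exchange_big /=.
rewrite exchange_big /=; apply: eq_bigr => b _.
rewrite {1}(xX (bas a)) {1}(xX (bas b)) (bilin_sum _ _ _ _ _ _ bm).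
rewrite linear_sum scaler_suml; apply: eq_bigr => i _.
rewrite linear_sum scaler_suml; apply: eq_bigr => j _.
by rewrite linearZ /= [in RHS]mulrC.
Qed.

End Dual.

(** * Group algebras and their duals *)

Section GroupHopf.
Variables (k : fieldType) (gT : finGroupType).
Local Notation kG := (group_hopf k gT).
Local Notation kGd := (dual_hopf kG).

Lemma group_hmul_bilin : bilin (@hmul k kG).
Proof. exact: ext2_bilin. Qed.

Lemma group_hmul_delta (g h : gT) :
  hmul (delta k g : kG) (delta k h : kG) = delta k (g * h)%g.
Proof. exact: (ext2_delta (fun g h => delta k (g * h)%g)). Qed.

Lemma group_comul_linear : linear (@comul k kG).
Proof. exact: ext1_linear. Qed.

Lemma group_comul_delta (g : gT) :
  comul (delta k g : kG) = (delta k g : kG) \ot (delta k g : kG).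
Proof. exact: (sum_delta_lin (fun g => (delta k g : kG) \ot (delta k g : kG))). Qed.

Lemma group_counit_linear : linear (@counit k kG).
Proof.
move=> c x y /=; rewrite scaler_sumr -big_split; apply: eq_bigr => g _ /=.
by rewrite !ffunE.
Qed.

Lemma group_counit_delta (g : gT) : counit (delta k g : kG) = 1.
Proof.
rewrite /= (bigD1 g) //= deltaE eqxx big1 ?addr0 // => h nhg.
by rewrite deltaE (negPf nhg).
Qed.

Lemma group_sw2_delta (U : vectType k) (b : kG -> kG -> U) g : bilin b ->
  sw2 b (delta k g : kG) = b (delta k g) (delta k g).
Proof. by move=> bb; rewrite /sw2 group_comul_delta tlift_pure. Qed.

(** The elements of the group are group-like, so the first clause of
    [no_abelian_factor] makes the group abelian. The algebra is then
    commutative, and as it is cocommutative in any case, every group element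
    and every linear character satisfies the centrality conditions of the
    third clause. *)
Lemma group_hopf_only_trivial_char : no_abelian_factor kG ->
  (forall g h : gT, commute g h) /\
  (forall rho : gT -> k, rho 1%g = 1 -> {morph rho : g h / (g * h)%g >-> g * h} ->
     forall g, rho g = 1).
Proof.
move=> [glC _ pair1].
have gl g : grouplike (delta k g : kG).
  by split; rewrite ?group_comul_delta ?group_counit_delta.
have cG (g h : gT) : commute g h.
  have /ffunP/(_ (g * h)%g) := glC _ _ (gl g) (gl h).
  rewrite !group_hmul_delta !deltaE eqxx; case: eqP => // _ /eqP.
  by rewrite oner_eq0.
split=> // rho rho1 rhoM g.
pose phi (u : kG) : k^o := \sum_g (u : {ffun gT -> k^o}) g * rho g.
have lphi : linear phi.
  move=> c x y; rewrite /phi scaler_sumr -big_split; apply: eq_bigr => h _ /=.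
  by rewrite !ffunE mulrDl -scalerAl.
have phiE h : phi (delta k h) = rho h.
  by rewrite -[RHS](sum_delta_lin (rho : gT -> k^o)).
rewrite -phiE; apply: pair1 => //.
- apply: delta_ext; [exact: bilin_r group_hmul_bilin|exact: (bilin_l _ group_hmul_bilin)|].
  by move=> h; rewrite !group_hmul_delta cG.
- split=> // [|x y]; first by rewrite /= phiE.
  have mulphi z : linear (fun z' => phi z * phi z' : k^o).
    exact: bilin_r (bilin_mul lphi lphi).
  move: y; apply: delta_ext => [||h] //.
    by apply: linear_comp => //; apply: bilin_r group_hmul_bilin.
  move: x; apply: delta_ext => [||h'].
  + by apply: linear_comp => //; apply: (bilin_l _ group_hmul_bilin).
  + exact: (bilin_l _ (bilin_mul lphi lphi)).
  by rewrite group_hmul_delta !phiE rhoM.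
- apply: delta_ext => [||h]; try exact: sw2_linear group_comul_linear.
  by rewrite !group_sw2_delta //; [exact: bilin_scale_flip|exact: bilin_scale].
Qed.

(** The dual situation: evaluations at group elements are characters and linear
    characters are group-like elements, so the second clause of
    [no_abelian_factor] replaces the first one. *)
Lemma dual_group_hopf_only_trivial_char : no_abelian_factor kGd ->
  (forall g h : gT, commute g h) /\
  (forall rho : gT -> k, rho 1%g = 1 -> {morph rho : g h / (g * h)%g >-> g * h} ->
     forall g, rho g = 1).
Proof.
pose X (g : gT) : kGd := dual_delta k g.
move=> [_ chC pair1]; pose ev g (f : kGd) : k^o := (f : 'Hom(kG, k^o)) (delta k g).
have lev g : linear (ev g) by move=> c x y; rewrite /ev add_lfunE scale_lfunE.
have evM g : forall x y, ev g (hmul x y) = ev g x * ev g y.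
  move=> x y; rewrite /ev dual_hmulE; last exact: group_comul_linear.
  by rewrite group_sw2_delta //; apply: bilin_mul; apply: linfun_linear.
have chev g : character (ev g).
  split=> //; rewrite /ev dual_honeE ?group_counit_delta //.
  exact: group_counit_linear.
have evX g h : ev g (X h) = (g == h)%:R.
  by rewrite /ev /X dual_deltaE deltaE eq_sym.
have comulE (f : kGd) : comul f = \sum_g \sum_h ev (g * h)%g f *: (X g \ot X h).
  rewrite (dual_comul_basis (x := fun g => delta k g : kG) (X := X)).
  - by apply: eq_bigr => g _; apply: eq_bigr => h _; rewrite group_hmul_delta.
  - exact: group_hmul_bilin.
  - by move=> u; rewrite {1}[u]ffun_delta; apply: eq_bigr => g _; rewrite dual_deltaE.
have sw2E (U : vectType k) (b : kGd -> kGd -> U) f : bilin b ->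
    sw2 b f = \sum_g \sum_h ev (g * h)%g f *: b (X g) (X h).
  move=> bb; rewrite /sw2 comulE raw_lin_sum; last exact: tlift_linear.
  apply: eq_bigr => g _; rewrite raw_lin_sum; last exact: tlift_linear.
  by apply: eq_bigr => h _; rewrite (raw_linZ _ _ (tlift_linear _)) tlift_pure.
have pick (W : lmodType k) (F : gT -> W) g : \sum_h ev g (X h) *: F h = F g.
  rewrite -[RHS](sum_delta_lin F); apply: eq_bigr => h _.
  by rewrite evX deltaE eq_sym.
have convE g h f : convol (ev g) (ev h) f = ev (g * h)%g f.
  rewrite /convol sw2E; last exact: bilin_mul.
  transitivity (\sum_g' ev g (X g') *: (\sum_h' ev h (X h') *: ev (g' * h')%g f)).
    apply: eq_bigr => g' _; rewrite scaler_sumr; apply: eq_bigr => h' _.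
    by rewrite scalerA [LHS]mulrC.
  by rewrite pick pick.
have cG (g h : gT) : commute g h.
  have /= := chC _ _ (chev g) (chev h) (X (g * h)%g).
  rewrite !convE !evX eqxx; case: eqP => // _ /eqP.
  by rewrite oner_eq0.
split=> // rho rho1 rhoM g.
pose z : kGd := \sum_h rho h *: X h.
have evz h : ev h z = rho h.
  rewrite /z raw_lin_sum // -[RHS](pick k^o rho); apply: eq_bigr => h' _.
  by rewrite raw_linZ // [LHS]mulrC.
rewrite -evz; apply: pair1 => //.
- split; last by rewrite -rho1 -evz.
  rewrite comulE (bilin_sum _ _ _ _ _ _ (pure_bilin kGd kGd)).
  by apply: eq_bigr => g' _; apply: eq_bigr => h' _; rewrite evz rhoM.
- by move=> f; apply: dual_ext => h; rewrite -!/(ev h _) !evM mulrC.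
- move=> f; rewrite !sw2E; [|exact: bilin_scale_flip|exact: bilin_scale].
  rewrite [in RHS]exchange_big /=.
  by apply: eq_bigr => g' _; apply: eq_bigr => h' _; rewrite cG.
Qed.

End GroupHopf.

(** * Dimensions of duals and doubles *)

Section Dimensions.
Variable k : fieldType.

Lemma dual_dim (H : hopf_data k) : \dim {: dual_hopf H} = \dim {: H}.
Proof. by rewrite !dimvf /= /dim /= muln1. Qed.

Lemma double_dim (H : hopf_data k) : \dim {: drinfeld_double H} = (\dim {: H} * \dim {: H})%N.
Proof. by rewrite dimvf /= dim_matrix -/(dual_hopf H) dual_dim. Qed.

End Dimensions.

(** * Linear characters of finite abelian groups *)

(** Each irreducible representation is one-dimensional, hence given by a linear
    character, hence trivial; so there is only one of them, while their number
    is the number of conjugacy classes, that is, the order of the group. *)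
Lemma abelian_only_trivial_char_card1 (k : closedFieldType) (char0 : [pchar k] =i pred0)
    (gT : finGroupType) :
  (forall g h : gT, commute g h) ->
  (forall rho : gT -> k, rho 1%g = 1 -> {morph rho : g h / (g * h)%g >-> g * h} ->
     forall g, rho g = 1) ->
  #|gT| = 1%N.
Proof.
move=> cgg triv.
pose G := [set: gT]%G.
have cGG : abelian G by apply/centsP=> x _ y _; apply: cgg.
have k'G : ([pchar k]^'.-group G)%g.
  by apply/pgroupP=> r _ _; rewrite inE /= char0.
have splitG : group_splitting_field k G by apply: group_closure_closed_field.
have sG : irrType k G := DecSocleType (regular_repr k G).
have lin := irr_degree_abelian splitG cGG (_ : sG).
have ZG x : x \in center G by apply/centerP; split=> [|y _]; rewrite ?inE.
have repr1 (i : sG) x : irr_repr i x = 1%:M.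
  rewrite irr_center_scalar // (triv (fun x => irr_mode i x)) ?irr_mode1 // => g h.
  by rewrite irr_modeM.
have card_sG : #|sG| = 1%N.
  apply/eqP/card1P => /=; exists (principal_comp sG) => i.
  rewrite !inE; apply/esym/socle_rsimP.
  exists (pid_mx 1) => [||x _].
  - by have := lin i; have := lin (principal_comp sG); rewrite /irr_degree => -> ->.
  - rewrite /row_free rank_pid_mx -/(irr_degree _) ?lin //.
  - have := repr1 i x; have := repr1 (principal_comp sG) x; rewrite /irr_repr => -> ->.
    by rewrite mul1mx mulmx1.
have := card_classes_abelian G.
by rewrite cGG -(card_irr_pchar sG k'G splitG) card_sG cardsT => /esym/eqP.
Qed.

(** * A Hopf algebra built from a cyclic group of inner automorphisms *)

Lemma sum_pick (V : nmodType) (I : finType) (F : I -> V) i :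
  (forall j, j != i -> F j = 0) -> \sum_j F j = F i.
Proof. by move=> F0; rewrite (bigD1 i) //= big1 ?addr0 // => j /F0. Qed.

(** The family [bb] plays the role of the powers b^l, for l mod q. *)
Section Model.
Variables (k : fieldType) (gT : finGroupType) (q : nat) (bb : 'Z_q -> gT).
Hypothesis bbD : forall l m, bb (l + m) = (bb l * bb m)%g.

Definition bconj (s : gT) (l : 'Z_q) : gT := (bb l * s * (bb l)^-1)%g.

Lemma bb0 : bb 0 = 1%g.
Proof. by apply: (mulgI (bb 0)); rewrite -bbD addr0 mulg1. Qed.

Lemma bbN l : bb (- l) = (bb l)^-1%g.
Proof. by apply: (mulgI (bb l)); rewrite -bbD subrr mulgV bb0. Qed.

Lemma bconj0 s : bconj s 0 = s.
Proof. by rewrite /bconj bb0 invg1 mulg1 mul1g. Qed.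

Lemma bconjD s l m : bconj (bconj s l) m = bconj s (l + m).
Proof. by rewrite /bconj addrC bbD invMg !mulgA. Qed.

Lemma bconjM s s' l : bconj (s * s') l = (bconj s l * bconj s' l)%g.
Proof. by rewrite /bconj !mulgA mulgKV. Qed.

Lemma bconj1 l : bconj 1 l = 1%g.
Proof. by rewrite /bconj mulg1 mulgV. Qed.

Lemma bconjV s l : bconj s^-1 l = (bconj s l)^-1%g.
Proof. by rewrite /bconj !invMg invgK mulgA. Qed.

Lemma bconjK l : cancel (bconj^~ l) (bconj^~ (- l)).
Proof. by move=> s; rewrite bconjD subrr bconj0. Qed.

Lemma bconj_fixP s l : reflect (commute s (bb l)) (bconj s l == s).
Proof.
apply: (iffP eqP) => [e|c]; last by rewrite /bconj -c mulgK.
by rewrite /commute -{1}e /bconj mulgKV.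
Qed.

(** The basis of the Hopf algebra below. The element [xi s l g] stands for the
    product of E_{s,l}, dual to e_s # x^l, by e_g # 1. *)
Definition xi (s : gT) (l : 'Z_q) (g : gT) : {ffun gT * 'Z_q * gT -> k^o} :=
  delta k (s, l, g).

(** The Hopf subalgebra of the double of k^G # kF generated by the dual of
    k^G # kF and by k^G, when the generator x of F acts on G as conjugation
    by [bb 1]. On the generators the defining relation is
    e_g E_{s,l} = E_{s,l} e_h with h = (b^l s b^-l)^-1 g s, which explains the
    condition in the product. *)
Definition model : hopf_data k :=
  @HopfData k {ffun gT * 'Z_q * gT -> k^o}
    (fun u v => \sum_x \sum_y (u x * v y) *:
      (if (x.1.2 == y.1.2) && (x.2 == bconj y.1.1 y.1.2 * y.2 * y.1.1^-1)%g
       then xi (x.1.1 * y.1.1) y.1.2 y.2 else 0))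
    (\sum_(j : 'Z_q * gT) xi 1 j.1 j.2)
    (fun u => \sum_x u x *: \sum_(j : 'Z_q * gT)
       (xi (bconj x.1.1 j.1) (x.1.2 - j.1) j.2 \ot xi x.1.1 j.1 (j.2^-1 * x.2)))
    (fun u => \sum_x u x * ((x.1.2 == 0) && (x.2 == 1%g))%:R)
    (fun u => \sum_x u x *:
      xi (bconj x.1.1^-1 x.1.2) (- x.1.2) (x.1.1 * x.2^-1 * bconj x.1.1^-1 x.1.2)).

Notation M := model.

Lemma xi_ext (W : lmodType k) (f g : M -> W) : linear f -> linear g ->
  (forall s l h, f (xi s l h) = g (xi s l h)) -> forall u, f u = g u.
Proof. by move=> lf lg e; apply: delta_ext => // [[[s l] h]]; apply: e. Qed.

Lemma model_hmul_bilin : bilin (@hmul k M).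
Proof. exact: ext2_bilin. Qed.

Lemma model_hmul_xi s l g s' l' g' : hmul (xi s l g : M) (xi s' l' g' : M) =
  if (l == l') && (g == bconj s' l' * g' * s'^-1)%g then xi (s * s') l' g' else 0.
Proof. exact: (ext2_delta (fun x y => if _ then _ else _)). Qed.

Lemma model_comul_linear : linear (@comul k M).
Proof. exact: ext1_linear. Qed.

Lemma model_comul_xi s l g : comul (xi s l g : M) =
  \sum_(j : 'Z_q * gT) (xi (bconj s j.1) (l - j.1) j.2 : M) \ot (xi s j.1 (j.2^-1 * g) : M).
Proof. exact: (sum_delta_lin (fun x => \sum_j (_ : tensor _ _))). Qed.

Lemma model_counit_linear : linear (@counit k M).
Proof.
move=> c x y /=; rewrite scaler_sumr -big_split; apply: eq_bigr => i _ /=.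
by rewrite !ffunE mulrDl -scalerAl.
Qed.

Lemma model_counit_xi s l g : counit (xi s l g : M) = ((l == 0) && (g == 1%g))%:R.
Proof. exact: (sum_delta_lin (fun x => ((x.1.2 == 0) && (x.2 == 1%g))%:R : k^o)). Qed.

Lemma model_sw2_xi (U : vectType k) (b : M -> M -> U) s l g : bilin b ->
  sw2 b (xi s l g : M) =
  \sum_(j : 'Z_q * gT) b (xi (bconj s j.1) (l - j.1) j.2) (xi s j.1 (j.2^-1 * g)%g).
Proof.
move=> bb'; rewrite /sw2 model_comul_xi raw_lin_sum; last exact: tlift_linear.
by apply: eq_bigr => j _; rewrite tlift_pure.
Qed.

Lemma xiE s l g s' l' g' :
  xi s l g (s', l', g') = [&& s' == s, l' == l & g' == g]%:R.
Proof. by rewrite /xi deltaE !xpair_eqE andbA. Qed.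

Lemma ev_linear (x : gT * 'Z_q * gT) : linear (fun u : M => (u : {ffun _ -> k^o}) x).
Proof. by move=> c u v; rewrite !ffunE. Qed.

(** Comparing coordinates on both sides of Delta u = u (x) u turns
    group-likeness into equations between the coordinates of u. *)
Lemma model_comul_coord (u : M) s1 l1 g1 s2 l2 g2 :
  sw2 (fun u1 u2 : M => (u1 : {ffun _ -> k^o}) (s1, l1, g1) *
                        (u2 : {ffun _ -> k^o}) (s2, l2, g2) : k^o) u =
  if s1 == bconj s2 l2 then (u : {ffun _ -> k^o}) (s2, l1 + l2, g1 * g2)%g else 0.
Proof.
have bev : bilin (fun u1 u2 : M => (u1 : {ffun _ -> k^o}) (s1, l1, g1) *
                        (u2 : {ffun _ -> k^o}) (s2, l2, g2) : k^o).
  by apply: bilin_mul; apply: ev_linear.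
move: u; apply: xi_ext => [||s l g].
- exact: sw2_linear model_comul_linear.
- by case: eqP => _ c u v; rewrite ?ev_linear ?scaler0 ?addr0.
rewrite model_sw2_xi // (bigD1 (l2, g1)) //= big1 ?addr0; last first.
  case=> m h; rewrite xpair_eqE !xiE /= => nlg.
  rewrite mulrC; case: (l2 =P m) => [e|_]; last by rewrite andbF mul0r.
  case: (g1 =P h) nlg => [->|_ _]; first by rewrite e !eqxx.
  by rewrite !andbF mulr0.
rewrite !xiE; have -> : (g1 * g2 == g)%g = (g2 == g1^-1 * g)%g.
  by apply/eqP/eqP => [<-|->]; rewrite ?mulKg ?mulKVg.
rewrite !eqxx /= andbT -natrM mulnb [l1 == _]eq_sym subr_eq [_ == l]eq_sym.
case: (s2 =P s) => [->|_] /=; last by rewrite andbF if_same.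
by case: (s1 == _).
Qed.

(** * Group-like elements and characters of the model *)

Definition triple_elt (s : gT) (lam : 'Z_q * gT -> k) : M :=
  \sum_j lam j *: (xi s j.1 j.2 : M).

(** A linear character of the product of the cyclic group and of [gT]. *)
Definition bichar (lam : 'Z_q * gT -> k) := lam (0, 1%g) = 1 /\
  forall l g m h, lam (l + m, g * h)%g = lam (l, g) * lam (m, h).

Lemma bichar_conj lam l g h : bichar lam -> lam (l, h * g * h^-1)%g = lam (l, g).
Proof.
move=> [lam1 lamM]; rewrite -{1}[l]addr0 lamM -{1}[l]add0r lamM mulrAC -lamM.
by rewrite addr0 mulgV lam1 mul1r.
Qed.

(** The coproduct only involves pairs of first components of the form
    (b^m s b^-m, s), so a tensor square can equal a coproduct only if a single
    s occurs, and this s is fixed by all conjugations by powers of b. *)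
Lemma grouplike_triple_elt (u : M) : grouplike u ->
  exists s lam, [/\ u = triple_elt s lam, forall l, bconj s l = s & bichar lam].
Proof.
case=> Du eu.
pose c s l g := (u : {ffun gT * 'Z_q * gT -> k^o}) (s, l, g) : k.
have cM s1 l1 g1 s2 l2 g2 : c s1 l1 g1 * c s2 l2 g2 =
    if s1 == bconj s2 l2 then c s2 (l1 + l2) (g1 * g2)%g else 0.
  rewrite -model_comul_coord /sw2 Du tlift_pure //.
  by apply: bilin_mul; apply: ev_linear.
have [s nz_s] : exists s, c s 0 1%g != 0.
  apply/existsP; rewrite -[[exists _, _]]negbK negb_exists; apply/negP=> /forallP c0.
  have := oner_neq0 k; rewrite -eu /= big1 ?eqxx // => -[[s l] g] _ /=.
  case: (l =P 0) => [->|_]; last by rewrite mulr0.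
  case: (g =P 1%g) => [->|_]; last by rewrite mulr0.
  by have := c0 s; rewrite negbK => /eqP; rewrite /c => ->; rewrite mul0r.
have supp s' l g : c s' l g != 0 -> s' = s.
  move=> nz; have := mulf_neq0 nz nz_s; rewrite cM bconj0.
  by case: (s' =P s) => // _; rewrite eqxx.
have fix_s l : bconj s l = s.
  apply: (supp _ (- l) 1%g); apply: contraNneq nz_s => c0.
  have := cM (bconj s l) (- l) 1%g s l 1%g.
  by rewrite c0 mul0r eqxx addNr mulg1 => <-.
have csM l g m h : c s (l + m) (g * h)%g = c s l g * c s m h.
  by rewrite cM fix_s eqxx.
exists s, (fun j => c s j.1 j.2); split=> //.
- rewrite [LHS]ffun_delta /triple_elt.
  rewrite (reindex (fun x : gT * ('Z_q * gT) => (x.1, x.2.1, x.2.2))) /=; last first.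
    by exists (fun x => (x.1.1, (x.1.2, x.2))) => [[s' []]|[[]]].
  rewrite -(pair_bigA _ (fun s' j => c s' j.1 j.2 *: xi s' j.1 j.2)) /=.
  rewrite (bigD1 s) //= [X in _ + X]big1 ?addr0 // => s' ns'.
  rewrite big1 // => j _; have [->|/supp] := eqVneq (c s' j.1 j.2) 0; first by rewrite scale0r.
  by move=> e; rewrite e eqxx in ns'.
- split=> // /=; apply: (mulIf nz_s).
  by rewrite -csM addr0 mulg1 mul1r.
Qed.

Lemma triple_elt_mul s lam s' lam' : (forall l, bconj s' l = s') -> bichar lam ->
  hmul (triple_elt s lam) (triple_elt s' lam') = triple_elt (s * s') (fun j => lam j * lam' j).
Proof.
move=> fix_s' blam; rewrite /triple_elt (bilin_sum _ _ _ _ _ _ model_hmul_bilin) exchange_big.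
apply: eq_bigr => -[l' g'] _; rewrite (sum_pick (i := (l', s' * g' * s'^-1)%g)) => [|[l g]].
  by rewrite model_hmul_xi fix_s' !eqxx bichar_conj.
rewrite xpair_eqE model_hmul_xi fix_s' => /negPf->.
by rewrite scaler0.
Qed.

(** The idempotents [xi 1 l g] are orthogonal with sum 1, so a character selects
    one pair (l0, g0). As [xi s l g] has a left and a right idempotent, which
    must both be the selected one, conjugation by [g0] agrees with
    conjugation by b^l0. *)
Lemma model_character (phi : M -> k^o) : character phi ->
  exists l0 g0 (c : gT -> k),
    [/\ forall s l g, phi (xi s l g) = if (l == l0) && (g == g0) then c s else 0,
        c 1%g = 1, {morph c : s s' / (s * s')%g >-> s * s'} &
        forall s, bconj s l0 = (g0 * s * g0^-1)%g].
Proof.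
case=> lphi phi1 phiM.
pose c s l g := phi (xi s l g) : k.
have cM s l g s' l' g' : c s l g * c s' l' g' =
    if (l == l') && (g == bconj s' l' * g' * s'^-1)%g then c (s * s')%g l' g' else 0.
  rewrite -[LHS]phiM model_hmul_xi; case: ifP => // _; exact: (raw_lin0 lphi).
have [[l0 g0] /= nz0] : exists j, c 1%g j.1 j.2 != 0.
  apply/existsP; rewrite -[[exists _, _]]negbK negb_exists; apply/negP=> /forallP c0.
  have := oner_neq0 k; rewrite -phi1 /= raw_lin_sum // big1 ?eqxx // => j _.
  by have := c0 j; rewrite negbK => /eqP.
have supp s l g : c s l g != 0 -> (l, g) = (l0, g0).
  move=> nz; have := mulf_neq0 nz nz0; rewrite cM bconj1 invg1 mul1g mulg1.
  by case: (l =P l0) => [->|_]; case: (g =P g0) => [->|_] //=; rewrite eqxx.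
have cV s : g0 = (bconj s l0 * g0 * s^-1)%g.
  suff nz : c s^-1%g l0 (bconj s l0 * g0 * s^-1)%g != 0 by case: (supp _ _ _ nz) => /esym.
  apply: contraNneq nz0 => c0.
  have := cM s^-1%g l0 (bconj s l0 * g0 * s^-1)%g s l0 g0.
  by rewrite c0 mul0r !eqxx mulVg /= => <-.
exists l0, g0, (fun s => c s l0 g0); split.
- move=> s l g; rewrite -/(c s l g); case: andP => [[/eqP-> /eqP->] //|nlg].
  by apply/eqP; apply: contraT => /supp [el eg]; case: nlg; rewrite el eg.
- apply: (mulIf nz0); rewrite cM eqxx bconj1 invg1 !mul1g mulg1 eqxx mul1r.
  by [].
- by move=> s s'; rewrite cM -cV !eqxx.
- by move=> s; rewrite {1}(cV s) mulgKV mulgK.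
Qed.

(** * The model has no abelian factor *)

Hypothesis cent1 : forall z : gT, (forall s, commute z s) -> z = 1%g.
Hypothesis bb_inj : forall l, bb l = 1%g -> l = 0.
Hypothesis cent_bb : forall s s' : gT,
  (forall l, commute s (bb l)) -> (forall l, commute s' (bb l)) -> commute s s'.

(** Two elements that induce the same inner automorphism are equal when the
    centre is trivial. *)
Lemma character_point l0 g0 : (forall s, bconj s l0 = (g0 * s * g0^-1)%g) -> g0 = bb l0.
Proof.
move=> e; suff : (g0^-1 * bb l0)%g = 1%g by move/(canRL (mulKVg _)); rewrite mulg1.
apply: cent1 => s; rewrite /commute.
have := e s; rewrite /bconj => /(canRL (mulgKV _)) e1.
by rewrite -mulgA e1 !mulgA mulVg mul1g.
Qed.

Lemma model_convolE (phi psi : M -> k^o) l1 g1 c l2 g2 d s l g :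
  linear phi -> linear psi ->
  (forall s l g, phi (xi s l g) = if (l == l1) && (g == g1) then c s else 0) ->
  (forall s l g, psi (xi s l g) = if (l == l2) && (g == g2) then d s else 0) ->
  convol phi psi (xi s l g : M) =
  if (l == l1 + l2) && (g == g1 * g2)%g then c (bconj s l2) * d s else 0.
Proof.
move=> lphi lpsi phiE psiE; rewrite /convol model_sw2_xi; last exact: bilin_mul.
rewrite (bigD1 (l2, g1)) //= big1 ?addr0.
  rewrite phiE psiE !eqxx /= andbT subr_eq.
  have -> : (g1^-1 * g == g2)%g = (g == g1 * g2)%g.
    by apply/eqP/eqP => [<-|->]; rewrite ?mulKg ?mulKVg.
  by case: eqP => _; case: eqP => _ //=; rewrite ?mulr0 ?mul0r.
case=> m h; rewrite xpair_eqE phiE psiE /=; case: (m =P l2) => [_|_]; last by rewrite mulr0.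
by case: (h =P g1) => [//|_ _]; rewrite andbF mul0r.
Qed.

Lemma model_no_abelian_factor : no_abelian_factor M.
Proof.
split.
- move=> y z /grouplike_triple_elt[s [lam [-> fix_s blam]]].
  move=> /grouplike_triple_elt[s' [lam' [-> fix_s' blam']]].
  have cent s1 : (forall l, bconj s1 l = s1) -> forall l, commute s1 (bb l).
    by move=> fx l; apply/bconj_fixP; rewrite fx.
  rewrite !triple_elt_mul // (cent_bb (cent _ fix_s) (cent _ fix_s')).
  by apply: eq_bigr => j _; rewrite mulrC.
- move=> phi psi cphi cpsi; have [[lphi _ _] [lpsi _ _]] := (cphi, cpsi).
  have [l1 [g1 [c [phiE c1 cM pt1]]]] := model_character cphi.
  have [l2 [g2 [d [psiE d1 dM pt2]]]] := model_character cpsi.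
  have conj_inv (e : gT -> k) s l : e 1%g = 1 -> {morph e : s s' / (s * s')%g >-> s * s'} ->
      e (bconj s l) = e s.
    by move=> e1 eM; rewrite /bconj !eM mulrAC -eM mulgV e1 mul1r.
  apply: xi_ext => [||s l g]; try exact: sw2_linear model_comul_linear.
  rewrite (model_convolE s l g lphi lpsi phiE psiE) (model_convolE s l g lpsi lphi psiE phiE).
  rewrite !conj_inv // (character_point pt1) (character_point pt2) -!bbD.
  by rewrite [l1 + l2]addrC [c s * d s]mulrC.
- move=> z phi /grouplike_triple_elt[s [lam [-> fix_s [lam1 lamM]]]] Zz cphi Zphi.
  have lphi : linear phi by case: cphi.
  have [l0 [g0 [c [phiE c1 cM pt]]]] := model_character cphi.
  have g0E := character_point pt.
  have s1 : s = 1%g.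
    apply: cent1 => s'; have := Zz (xi s' 0 1%g).
    rewrite /triple_elt (bilin_suml model_hmul_bilin) (bilin_sumr model_hmul_bilin).
    rewrite (sum_pick (i := (0, 1%g))) => [|[l g]]; last first.
      rewrite xpair_eqE (bilin_Zl model_hmul_bilin) model_hmul_xi.
      by rewrite bconj0 mulg1 mulgV => /negPf->; rewrite scaler0.
    rewrite [RHS](sum_pick (i := (0, 1%g))) => [|[l g]]; last first.
      rewrite xpair_eqE (bilin_Zr model_hmul_bilin) model_hmul_xi fix_s.
      rewrite [0 == _]eq_sym [1%g == _]eq_sym (_ : (s * g * s^-1 == 1)%g = (g == 1%g)).
        by move/negPf->; rewrite scaler0.
      apply/eqP/eqP => [e|->]; last by rewrite mulg1 mulgV.
      by apply: (mulgI s); apply: (mulIg s^-1%g); rewrite e mulg1 mulgV.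
    rewrite (bilin_Zl model_hmul_bilin) (bilin_Zr model_hmul_bilin).
    rewrite !model_hmul_xi !bconj0 !mulg1 !mulgV !eqxx lam1 !scale1r /=.
    move=> /ffunP/(_ (s * s', 0, 1)%g).
    by rewrite !xiE !eqxx /= andbT; case: eqP => // _ /eqP; rewrite oner_eq0.
  have l0_0 : l0 = 0.
    apply: bb_inj; apply: cent1 => s'; apply/commute_sym/bconj_fixP.
    have := Zphi (xi s' l0 g0).
    rewrite !model_sw2_xi; [|exact: bilin_scale_flip|exact: bilin_scale].
    rewrite (sum_pick (i := (0, g0))) => [|[m h]]; last first.
      rewrite phiE xpair_eqE subr_eq -{1}[l0]addr0 (inj_eq (addrI l0)) [0 == _]eq_sym.
      by move/negPf->; rewrite scale0r.
    rewrite [RHS](sum_pick (i := (l0, 1%g))) => [|[m h]]; last first.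
      rewrite phiE xpair_eqE (_ : (h^-1 * g0 == g0)%g = (h == 1%g)).
        by move/negPf->; rewrite scale0r.
      rewrite -{2}[g0]mul1g (inj_eq (mulIg g0)) eq_sym.
      by apply/eqP/eqP => [e|->]; rewrite ?invg1 // -[h]invgK -e invg1.
    rewrite !phiE bconj0 subrr subr0 invg1 mul1g mulVg !eqxx.
    move=> /ffunP/(_ (s', 0, 1%g)); rewrite ![in RHS]ffunE ![in LHS]ffunE !eqxx !andbT.
    have : c s' != 0.
      apply: contra_neq (oner_neq0 k) => cs0.
      by rewrite -c1 -(mulgV s') cM cs0 mul0r.
    move=> nzc; rewrite /= !xpair_eqE !eqxx !andbT eq_sym; case: eqP => // _.
    by move/eqP; rewrite scaler0 scaler_eq0 (negPf nzc) oner_eq0.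
  rewrite /triple_elt (raw_lin_sum _ _ _ lphi) (sum_pick (i := (l0, g0))) => [|[l g]].
    by rewrite raw_linZ // phiE !eqxx s1 c1 g0E l0_0 bb0 lam1 scale1r.
  rewrite xpair_eqE raw_linZ // phiE => /negPf->.
  by rewrite scaler0.
Qed.

End Model.

(** * The bismash product and its dual *)

Section Bismash.
Variables (k : fieldType) (gT : finGroupType) (q : nat) (bb : 'Z_q -> gT).
Hypothesis bbD : forall l m, bb (l + m) = (bb l * bb m)%g.
Variable ac : gT -> 'Z_q -> gT.
Hypothesis acE : forall s l, ac s l = bconj bb s l.

Definition smash := bismash k ac.
(** In the notation of Hopf algebra texts, [ee g m] is e_g # x^m, and [EE s l],
    also written E_{s,l}, is the functional dual to [ee s l]. *)
Definition ee (g : gT) (m : 'Z_q) : smash := delta k (g, m).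
Definition EE (s : gT) (l : 'Z_q) : dual_hopf smash := dual_delta k (s, l).
Local Notation "s \^ l" := (bconj bb s l) (at level 30).

Lemma smash_hmul_bilin : bilin (@hmul k smash).
Proof.
suff e (u v : smash) : hmul u v = \sum_(x : gT * 'Z_q) \sum_(y : gT * 'Z_q)
    ((u : {ffun gT * 'Z_q -> k^o}) x * (v : {ffun gT * 'Z_q -> k^o}) y) *:
    (if ac x.1 x.2 == y.1 then ee x.1 (x.2 * y.2)%g else 0).
  have [br bl] := ext2_bilin (fun x y : gT * 'Z_q =>
    if ac x.1 x.2 == y.1 then ee x.1 (x.2 * y.2)%g else 0).
  by split=> z c x y; rewrite !e; [apply: br|apply: bl].
apply: eq_bigr => x _; apply: eq_bigr => y _.
by case: ifP => _ //; rewrite scaler0.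
Qed.

Lemma smash_hmul g m g' m' : hmul (ee g m) (ee g' m') =
  if g \^ m == g' then ee g (m + m') else 0.
Proof.
rewrite -acE -[RHS](ext2_delta (fun x y : gT * 'Z_q =>
   if ac x.1 x.2 == y.1 then ee x.1 (x.2 * y.2)%g else 0) (g, m) (g', m')).
apply: eq_bigr => x _; apply: eq_bigr => y _.
by case: ifP => _ //; rewrite scaler0.
Qed.

Lemma smash_comul_linear : linear (@comul k smash).
Proof. exact: ext1_linear. Qed.

Lemma smash_sw2 (U : vectType k) (b : smash -> smash -> U) g m : bilin b ->
  sw2 b (ee g m) = \sum_x b (ee x m) (ee (x^-1 * g)%g m).
Proof.
move=> hb; rewrite /sw2.
rewrite [comul _](sum_delta_lin (fun s : gT * 'Z_q =>
   \sum_(r : gT * gT | (r.1 * r.2)%g == s.1) (ee r.1 s.2 \ot ee r.2 s.2)) (g, m)).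
rewrite (raw_lin_sum _ _ _ (tlift_linear b)) /=.
rewrite (reindex (fun x => (x, x^-1 * g)%g)) /=; last first.
  exists (fun r => r.1) => [//|[x y]]; rewrite inE /= => /eqP<-.
  by rewrite mulKg.
apply: eq_big => [x|x _]; first by rewrite mulKVg eqxx.
by rewrite tlift_pure.
Qed.

Lemma smash_sw2r (U : vectType k) (b : smash -> smash -> U) g m : bilin b ->
  sw2 b (ee g m) = \sum_y b (ee (g * y^-1)%g m) (ee y m).
Proof.
move=> hb; rewrite smash_sw2 // (reindex (fun y => g * y^-1)%g) /=.
  by apply: eq_bigr => y _; rewrite invMg invgK mulgKV.
by exists (fun x => x^-1 * g)%g => y _; rewrite ?invMg ?invgK ?mulgKV ?mulKVg.
Qed.

Lemma smash_counit_linear : linear (@counit k smash).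
Proof.
move=> c x y /=; rewrite scaler_sumr -big_split; apply: eq_bigr => l _ /=.
by rewrite !ffunE.
Qed.

Lemma smash_counit g m : counit (ee g m) = (g == 1%g)%:R.
Proof.
rewrite /= (sum_pick (i := m)) => [|l nlm].
  by rewrite ffunE xpair_eqE eqxx andbT eq_sym.
by rewrite ffunE xpair_eqE (negPf nlm) andbF.
Qed.

Lemma smash_antipode_linear : linear (@antipode k smash).
Proof. exact: ext1_linear. Qed.

Lemma smash_antipode g m : antipode (ee g m) = ee (g \^ m)^-1%g (- m).
Proof.
rewrite -acE.
exact: (sum_delta_lin (fun s : gT * 'Z_q => ee (ac s.1 s.2)^-1 s.2^-1%g) (g, m)).
Qed.

(** The antipode is an involution, so the inverse in the definition of the
    double is the antipode itself. *)
Lemma smash_antipode_inv (h : smash) : antipode_inv h = antipode h.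
Proof.
have lS := smash_antipode_linear; have SE := raw_linfunE lS.
have SS (x : smash) : antipode (antipode x) = x.
  move: x; apply: delta_ext => [|//|[g m]]; first exact: linear_comp.
  rewrite -/(ee g m) !smash_antipode opprK bconjV (bconjK bbD) !invgK.
  by [].
rewrite /antipode_inv; set S := linfun _.
have kerS : lker S == 0%VS.
  by apply/lker0P => x y; rewrite !SE => e; rewrite -[x]SS e SS.
by rewrite -{1}[h]SS -SE lker0_lfunK.
Qed.

Lemma EE_ee s l g m : (EE s l : 'Hom(smash, k^o)) (ee g m) = ((s == g) && (l == m))%:R.
Proof. by rewrite dual_deltaE deltaE xpair_eqE. Qed.

Lemma smash_dual_ext (f g : dual_hopf smash) : (forall x m,
  (f : 'Hom(smash, k^o)) (ee x m) = (g : 'Hom(smash, k^o)) (ee x m)) -> f = g.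
Proof. by move=> e; apply: dual_ext => -[x m]; apply: e. Qed.

Lemma smash_dual_sum (f : dual_hopf smash) :
  f = \sum_x (f : 'Hom(smash, k^o)) (delta k x) *: EE x.1 x.2.
Proof.
apply: smash_dual_ext => g m; rewrite sum_lfunE (sum_pick (i := (g, m))) => [|[s l] /negPf n].
  by rewrite scale_lfunE EE_ee !eqxx [RHS]mulr1.
by rewrite scale_lfunE EE_ee -xpair_eqE n [LHS]mulr0.
Qed.

Lemma smash_dual_hmul_bilin : bilin (@hmul k (dual_hopf smash)).
Proof.
have sw (f g : dual_hopf smash) x := dual_hmulE f g x smash_comul_linear.
split=> [f|g] c x y; apply/lfunP=> h; rewrite add_lfunE scale_lfunE !sw /sw2.
  apply: (tlift_param_linear (b := fun (x : 'Hom(smash, k^o)) (h1 h2 : smash) =>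
    (f : 'Hom(smash, k^o)) h1 * x h2 : k^o)) => u v d z t.
  by rewrite add_lfunE scale_lfunE mulrDr -scalerAr.
apply: (tlift_param_linear (b := fun (x : 'Hom(smash, k^o)) (h1 h2 : smash) =>
  x h1 * (g : 'Hom(smash, k^o)) h2 : k^o)) => u v d z t.
by rewrite add_lfunE scale_lfunE mulrDl -scalerAl.
Qed.

Lemma smash_dual_hmul s l s' l' : hmul (EE s l) (EE s' l') =
  if l == l' then EE (s * s')%g l else 0.
Proof.
apply: smash_dual_ext => g m; rewrite dual_hmulE; last exact: smash_comul_linear.
rewrite smash_sw2; last by apply: bilin_mul; apply: linfun_linear.
rewrite (sum_pick (i := s)) => [|x nxs]; last first.
  by rewrite EE_ee eq_sym (negPf nxs) mul0r.
rewrite !EE_ee eqxx /= -natrM mulnb.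
have -> : (s' == s^-1 * g)%g = (s * s' == g)%g.
  by apply/eqP/eqP => [->|<-]; rewrite ?mulKg ?mulKVg.
case: (l =P l') => [<-|nll]; first by rewrite EE_ee andbCA andbb.
rewrite zero_lfunE; case: (l =P m) => //= lm; case: (l' =P m) => [l'm|]; last by rewrite andbF.
by case: nll; rewrite lm l'm.
Qed.

Lemma smash_dual_one : hone (dual_hopf smash) = \sum_l EE 1%g l.
Proof.
apply: smash_dual_ext => g m; rewrite dual_honeE; last exact: smash_counit_linear.
rewrite smash_counit sum_lfunE (sum_pick (i := m)) => [|l nlm].
  by rewrite EE_ee eqxx andbT eq_sym.
by rewrite EE_ee (negPf nlm) andbF.
Qed.

Lemma smash_dual_comul s l : comul (EE s l) =
  \sum_m EE s m \ot EE (s \^ m) (l - m).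
Proof.
have coef g m g' m' : (EE s l : 'Hom(smash, k^o)) (hmul (ee g m) (ee g' m')) =
    ((g == s) && ((g', m') == (s \^ m, l - m)))%:R.
  rewrite smash_hmul xpair_eqE [g' == _]eq_sym [m' == _]eq_sym subr_eq [_ + m]addrC.
  case: (g =P s) => [->|ngs] /=; case: eqP => _; rewrite ?linear0 //.
    by rewrite EE_ee eqxx.
  by rewrite EE_ee eq_sym; case: eqP ngs.
rewrite (dual_comul_basis (x := fun x => ee x.1 x.2) (X := fun x => EE x.1 x.2)) //.
- transitivity (\sum_(x : gT * 'Z_q) (x.1 == s)%:R *: (EE s x.2 \ot EE (s \^ x.2) (l - x.2))).
    apply: eq_bigr => -[g m] _.
    rewrite (sum_pick (i := (s \^ m, l - m))) => [|[g' m'] /negPf n].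
      by rewrite coef eqxx andbT; case: eqP => [->|_] //; rewrite !scale0r.
    by rewrite coef n andbF scale0r.
  rewrite -(pair_bigA _ (fun g m => (g == s)%:R *: (EE s m \ot EE (s \^ m) (l - m)))).
  rewrite (sum_pick (i := s)) => [|g /negPf->]; last first.
    by rewrite big1 // => m _; rewrite scale0r.
  by apply: eq_bigr => m _; rewrite eqxx scale1r.
- exact: smash_hmul_bilin.
- by move=> u; rewrite {1}[u]ffun_delta; apply: eq_bigr => -[g m] _; rewrite dual_deltaE.
Qed.

Lemma smash_one : hone smash = \sum_g ee g 0. Proof. by []. Qed.

Lemma smash_dual_counit s l : counit (EE s l) = (l == 0)%:R.
Proof.
rewrite -[LHS]/((EE s l : 'Hom(smash, k^o)) (hone smash)) smash_one.
rewrite (raw_lin_sum _ _ _ (linfun_linear _)).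
rewrite (sum_pick (i := s)) => [|g ngs]; first by rewrite EE_ee eqxx.
by rewrite EE_ee eq_sym (negPf ngs).
Qed.

(** * The double of the bismash product *)

Definition sdouble := drinfeld_double smash.

Lemma hitE (a b c : smash) (f : dual_hopf smash) :
  (hit a f b : 'Hom(smash, k^o)) c = (f : 'Hom(smash, k^o)) (hmul (hmul b c) a).
Proof.
rewrite /hit raw_linfunE //; apply: linear_comp (linfun_linear _) _.
by apply: linear_comp (bilin_l _ smash_hmul_bilin) (bilin_r _ smash_hmul_bilin).
Qed.

Lemma hit_linear_l (f : dual_hopf smash) (b : smash) : linear (fun a => hit a f b).
Proof.
move=> c x y; apply/lfunP=> h; rewrite add_lfunE scale_lfunE !hitE.
by rewrite (bilin_r _ smash_hmul_bilin) linearP.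
Qed.

Lemma hit_linear_r (a : smash) (f : dual_hopf smash) : linear (fun b => hit a f b).
Proof.
move=> c x y; apply/lfunP=> h; rewrite add_lfunE scale_lfunE !hitE.
have [_ bl] := smash_hmul_bilin.
by have /= -> := bl h c x y; have /= -> := bl a c (hmul x h) (hmul y h); rewrite linearP.
Qed.

Lemma hit_linear_m (a b : smash) : linear (fun f : dual_hopf smash => hit a f b).
Proof.
by move=> c x y; apply/lfunP=> h; rewrite add_lfunE scale_lfunE !hitE add_lfunE scale_lfunE.
Qed.

Lemma sw3_linear (U : vectType k) (b : smash -> smash -> smash -> U) : linear (sw3 b).
Proof. exact: sw2_linear smash_comul_linear. Qed.

Lemma sw3_param_linear (X U : vectType k) (b : X -> smash -> smash -> smash -> U) h :
  (forall h1 h2 h3, linear (fun x => b x h1 h2 h3)) -> linear (fun x => sw3 (b x) h).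
Proof.
move=> lb; apply: (tlift_param_linear (b := fun x h1 h' => sw2 (fun h2 h3 => b x h1 h2 h3) h')).
move=> h1 h'; apply: (tlift_param_linear (b := fun x h2 h3 => b x h1 h2 h3)) => h2 h3.
exact: lb.
Qed.

Lemma smash_sw3 (U : vectType k) (b : smash -> smash -> smash -> U) g m :
  (forall h1 h2, linear (b h1 h2)) -> (forall h1 h3, linear (fun h2 => b h1 h2 h3)) ->
  (forall h2 h3, linear (fun h1 => b h1 h2 h3)) ->
  sw3 b (ee g m) = \sum_x \sum_y b (ee x m) (ee (x^-1 * g * y^-1)%g m) (ee y m).
Proof.
move=> l3 l2 l1; rewrite /sw3 smash_sw2; last first.
  split=> [h1|h']; first exact: sw2_linear smash_comul_linear.
  apply: (tlift_param_linear (b := fun h1 h2 h3 => b h1 h2 h3)) => h2 h3.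
  exact: l1.
by apply: eq_bigr => x _; rewrite smash_sw2r //.
Qed.

(** The product (f (x) h)(g (x) l) in the double, before linear extension. *)
Definition dterm (f : dual_hopf smash) (h : smash) (g : dual_hopf smash) (l : smash) :
    tensor (dual_hopf smash) smash :=
  sw3 (fun h1 h2 h3 => hmul f (hit h1 g (antipode_inv h3)) \ot hmul h2 l) h.

Lemma Sinv_linear : linear (@antipode_inv k smash).
Proof. by move=> c x y; rewrite !smash_antipode_inv smash_antipode_linear. Qed.

Lemma dmul_pure (f : dual_hopf smash) (h : smash) (g : dual_hopf smash) (l : smash) :
  hmul (f \ot h : sdouble) (g \ot l : sdouble) = dterm f h g l.
Proof.
have pb := pure_bilin (dual_hopf smash) smash.
have [mH mHd] := (smash_hmul_bilin, smash_dual_hmul_bilin).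
have inner f' h' : bilin (dterm f' h').
  split=> [g'|l'].
    apply: (sw3_param_linear (b := fun l' h1 h2 h3 =>
      hmul f' (hit h1 g' (antipode_inv h3)) \ot hmul h2 l')) => h1 h2 h3.
    exact: linear_comp (bilin_r _ pb) (bilin_r _ mH).
  apply: (sw3_param_linear (b := fun (g' : 'Hom(smash, k^o)) h1 h2 h3 =>
    hmul f' (hit h1 g' (antipode_inv h3)) \ot hmul h2 l')) => h1 h2 h3.
  apply: (linear_comp (bilin_l _ pb)); apply: (linear_comp (bilin_r _ mHd)).
  exact: hit_linear_m.
rewrite -[LHS]/(tlift (fun f' h' => tlift (dterm f' h') (g \ot l)) (f \ot h)).
rewrite tlift_pure ?tlift_pure //; split=> [f'|h'].
  apply: (tlift_param_linear (b := fun h' g' l' => dterm f' h' g' l')) => g' l'.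
  exact: sw3_linear.
apply: (tlift_param_linear (b := fun (f' : 'Hom(smash, k^o)) g' l' => dterm f' h' g' l')) => g' l'.
apply: (sw3_param_linear (b := fun (f' : 'Hom(smash, k^o)) h1 h2 h3 =>
    hmul (f' : dual_hopf smash) (hit h1 g' (antipode_inv h3)) \ot hmul h2 l')) => h1 h2 h3.
by apply: (linear_comp (bilin_l _ pb)); apply: (bilin_l _ mHd).
Qed.

Definition BB s l g m : sdouble := EE s l \ot ee g m.

(** In the iterated coproduct of [ee g m] the outer two factors act on
    E_{s,l} by zero, except for one choice of them. Hence the double sum in
    the product of two basis elements of the double has at most one nonzero
    term. *)
Lemma hit_basis x y s l m : hit (ee x m) (EE s l) (antipode_inv (ee y m)) =
  if (y == (s \^ - m)^-1)%g && (x == s \^ (l - m)) then EE (s \^ - m) l else 0.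
Proof.
apply: smash_dual_ext => u n; rewrite hitE smash_antipode_inv smash_antipode smash_hmul.
rewrite bconjV (bconjK bbD).
set t := (y \^ m)^-1%g.
have -> : (y == (s \^ - m)^-1)%g = (t == s).
  apply/eqP/eqP => [e|<-].
    by rewrite /t e bconjV invgK -{2}[m]opprK (bconjK bbD).
  by rewrite /t bconjV invgK (bconjK bbD).
have tN : (y^-1 = t \^ - m)%g by rewrite /t -bconjV (bconjK bbD).
case: (t =P s) => [<-|nts]; rewrite ?andTb ?andFb; last first.
  rewrite zero_lfunE; case: eqP => _; last by rewrite (bilin_0l smash_hmul_bilin) linear0.
  rewrite smash_hmul; case: eqP => _; last by rewrite linear0.
  by rewrite EE_ee eq_sym; case: eqP nts.
rewrite tN; case: ((t \^ (- m))%g =P u) => [tu|ntu]; last first.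
  rewrite (bilin_0l smash_hmul_bilin) linear0; case: ifP => _; last by rewrite zero_lfunE.
  by rewrite EE_ee; case: eqP ntu.
rewrite smash_hmul addrAC addNr add0r; case: (l =P n) => [<-|nln].
  rewrite [- m + l]addrC [x == _]eq_sym; case: ifP => _; last by rewrite linear0 zero_lfunE.
  by rewrite !EE_ee tu !eqxx.
have z s1 g1 : (EE s1 l : 'Hom(smash, k^o)) (ee g1 n) = 0.
  by rewrite EE_ee (negPf (introN eqP nln)) andbF.
by case: ifP => _; case: ifP => _; rewrite ?linear0 ?zero_lfunE ?z.
Qed.

Lemma BB_mul s l g m s' l' g' m' : hmul (BB s l g m) (BB s' l' g' m') =
  if (l == l') && ((((s' \^ (l' - m))^-1 * g * (s' \^ - m)) \^ m)%g == g')
  then BB (s * (s' \^ - m)) l ((s' \^ (l' - m))^-1 * g * (s' \^ - m)) (m + m') else 0.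
Proof.
have pb := pure_bilin (dual_hopf smash) smash.
have [mH mHd] := (smash_hmul_bilin, smash_dual_hmul_bilin).
rewrite dmul_pure /dterm smash_sw3.
- rewrite (sum_pick (i := s' \^ (l' - m))) => [|x nx]; last first.
    rewrite big1 // => y _.
    by rewrite hit_basis (negPf nx) andbF (bilin_0r mHd) (bilin_0l pb).
  rewrite (sum_pick (i := (s' \^ - m)^-1)%g) => [|y ny]; last first.
    by rewrite hit_basis (negPf ny) (bilin_0r mHd) (bilin_0l pb).
  rewrite hit_basis !eqxx invgK smash_dual_hmul smash_hmul /=.
  case: eqP => _ /=; last by rewrite (bilin_0l pb).
  by case: eqP => _ //; rewrite (bilin_0r pb).
- move=> h1 h2; apply: (linear_comp (bilin_l _ pb)); apply: (linear_comp (bilin_r _ mHd)).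
  exact: linear_comp (hit_linear_r _ _) Sinv_linear.
- move=> h1 h3; apply: (linear_comp (bilin_r _ pb)); exact: (bilin_l _ mH).
- move=> h2 h3; apply: (linear_comp (bilin_l _ pb)); apply: (linear_comp (bilin_r _ mHd)).
  exact: hit_linear_l.
Qed.

Lemma sdouble_hmul_bilin : bilin (@hmul k sdouble).
Proof.
split=> [z|w] c x y; last exact: tlift_linear.
apply: (tlift_param_linear (X := tensor (dual_hopf smash) smash)
  (b := fun w f h => tlift (dterm f h) w)) => f h.
exact: tlift_linear.
Qed.

Lemma sdouble_ext (W : vectType k) (F G : sdouble -> W) : linear F -> linear G ->
  (forall s l g m, F (BB s l g m) = G (BB s l g m)) -> forall d, F d = G d.
Proof.
move=> lF lG e d; have pb := pure_bilin (dual_hopf smash) smash.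
move: d; apply: (@tensor_ext k (dual_hopf smash) smash W F G) => // f h.
move: h; apply: delta_ext => [||[g m]].
- exact: (linear_comp lF (bilin_r f pb)).
- exact: (linear_comp lG (bilin_r f pb)).
rewrite (smash_dual_sum f) !(bilin_suml pb) (raw_lin_sum _ _ _ lF) (raw_lin_sum _ _ _ lG).
apply: eq_bigr => -[s l] _.
by rewrite !(bilin_Zl pb) (raw_linZ _ _ lF) (raw_linZ _ _ lG); congr (_ *: _); apply: e.
Qed.

Lemma smash_dual_comul_linear : linear (@comul k (dual_hopf smash)).
Proof.
move=> c x y; rewrite /= scaler_sumr -big_split; apply: eq_bigr => i _ /=.
rewrite scaler_sumr -big_split; apply: eq_bigr => j _ /=.
by rewrite add_lfunE scale_lfunE scalerDl scalerA.
Qed.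

Lemma sdouble_comul_linear : linear (@comul k sdouble).
Proof. exact: tlift_linear. Qed.

Lemma sdouble_counit_linear : linear (@counit k sdouble).
Proof. exact: tlift_linear. Qed.

Lemma sdouble_sw2 (U : vectType k) (b : sdouble -> sdouble -> U) s l g m : bilin b ->
  sw2 b (BB s l g m) =
  \sum_n \sum_x b (BB (s \^ n) (l - n) x m) (BB s n (x^-1 * g)%g m).
Proof.
have pb := pure_bilin (dual_hopf smash) smash; have pbD := pure_bilin sdouble sdouble.
move=> hb; rewrite {1}/sw2.
pose dD (f : dual_hopf smash) (h : smash) : tensor sdouble sdouble :=
  sw2 (fun f1 f2 => sw2 (fun h1 h2 => (f2 \ot h1 : sdouble) \ot (f1 \ot h2 : sdouble)) h) f.
have bD : bilin dD.
  split=> [f|h]; last exact: sw2_linear smash_dual_comul_linear.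
  apply: (tlift_param_linear (b := fun h f1 f2 =>
    sw2 (fun h1 h2 => (f2 \ot h1 : sdouble) \ot (f1 \ot h2 : sdouble)) h)).
  by move=> f1 f2; apply: sw2_linear smash_comul_linear.
rewrite -[comul _]/(tlift dD (EE s l \ot ee g m)) tlift_pure //.
have -> : dD (EE s l) (ee g m) =
    \sum_n \sum_x (BB (s \^ n) (l - n) x m \ot BB s n (x^-1 * g)%g m).
  rewrite /dD /sw2 smash_dual_comul (raw_lin_sum _ _ _ (tlift_linear _)).
  apply: eq_bigr => n _; rewrite tlift_pure; last first.
    split=> [f1|f2].
      apply: (tlift_param_linear (b := fun f2 h1 h2 =>
        (f2 \ot h1 : sdouble) \ot (f1 \ot h2 : sdouble))).
      by move=> h1 h2; apply: (linear_comp (bilin_l _ pbD)); apply: (bilin_l _ pb).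
    apply: (tlift_param_linear (b := fun f1 h1 h2 =>
        (f2 \ot h1 : sdouble) \ot (f1 \ot h2 : sdouble))).
    by move=> h1 h2; apply: (linear_comp (bilin_r _ pbD)); apply: (bilin_l _ pb).
  rewrite -/(sw2 _ _) smash_sw2 //.
  by apply: (bilin_comp pbD); apply: bilin_r.
rewrite (raw_lin_sum _ _ _ (tlift_linear b)); apply: eq_bigr => n _.
rewrite (raw_lin_sum _ _ _ (tlift_linear b)); apply: eq_bigr => x _.
by rewrite tlift_pure.
Qed.

Lemma sdouble_counit s l g m : counit (BB s l g m) = ((l == 0) && (g == 1%g))%:R.
Proof.
rewrite -[LHS]/(tlift (fun (f : dual_hopf smash) (h : smash) =>
  counit f * counit h : k^o) (EE s l \ot ee g m)).
rewrite tlift_pure ?smash_dual_counit ?smash_counit; first by rewrite -natrM mulnb.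
apply: bilin_mul smash_counit_linear.
by move=> c x y; rewrite /= add_lfunE scale_lfunE.
Qed.

Lemma sdouble_one : hone sdouble = \sum_l \sum_g BB 1%g l g 0.
Proof.
have pb := pure_bilin (dual_hopf smash) smash.
rewrite -[LHS]/(hone (dual_hopf smash) \ot hone smash) smash_dual_one smash_one (bilin_suml pb).
by apply: eq_bigr => l _; rewrite (bilin_sumr pb).
Qed.

(** * The quotient of the double by the central group-like element *)

Variable wp : 'Z_q -> k.
Hypothesis wp0 : wp 0 = 1.
Hypothesis wpD : forall l m, wp (l + m) = wp l * wp m.

Local Notation M := (model k bb).

(** As chi x becomes 1 in the quotient and x^m = (chi x)^m chi^-m, the basis
    element [BB s l g m] becomes a multiple of [BB (s * (bb m)^-1) l _ 0]; the
    scalar is the inverse of the value of chi^m at x^l, with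
    wp l = omega^l. *)
Definition theta_term (u v : {ffun gT * 'Z_q -> k^o}) : M :=
  \sum_x \sum_y (u x * v y) *:
    (wp (- (x.2 * y.2)) *: (xi k (x.1 * (bb y.2)^-1)%g x.2 (y.1 \^ y.2) : M)).

Definition theta : sdouble -> M := tlift (fun (f : dual_hopf smash) (h : smash) =>
  theta_term [ffun x => (f : 'Hom(smash, k^o)) (delta k x)] h).

Lemma theta_linear : linear theta.
Proof. exact: tlift_linear. Qed.

Lemma theta_BB s l g m : theta (BB s l g m) =
  wp (- (l * m)) *: (xi k (s * (bb m)^-1)%g l (g \^ m) : M).
Proof.
rewrite /theta tlift_pure; last first.
  apply: (bilin_comp (V' := dual_hopf smash) (W' := smash) (b := theta_term)
    (f := fun f : dual_hopf smash => [ffun x => (f : 'Hom(smash, k^o)) (delta k x)])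
    (g := fun h => h)) => //; first exact: ext2_bilin.
  by move=> c x y; apply/ffunP=> i; rewrite !ffunE add_lfunE scale_lfunE.
rewrite (_ : finfun _ = delta k (s, l)).
  exact: (ext2_delta (fun x y => _ *: xi k _ _ _) (s, l) (g, m)).
by apply/ffunP=> -[x n]; rewrite !ffunE -/(ee x n) EE_ee xpair_eqE eq_sym [l == _]eq_sym.
Qed.

Lemma bconj_bb l m : bb l \^ m = bb l.
Proof. by apply/eqP/bconj_fixP; rewrite /commute -!bbD addrC. Qed.

Lemma theta_mul x y : theta (hmul x y) = hmul (theta x) (theta y).
Proof.
have mD := sdouble_hmul_bilin; have mM := @model_hmul_bilin k gT q bb.
have lt := theta_linear.
move: y; apply: sdouble_ext => [||s' l' g' m'].
- exact: (linear_comp lt (bilin_r _ mD)).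
- exact: (linear_comp (bilin_r _ mM) lt).
move: x; apply: sdouble_ext => [||s l g m].
- exact: (linear_comp lt (bilin_l _ mD)).
- exact: (linear_comp (bilin_l _ mM) lt).
rewrite BB_mul !theta_BB (bilin_Zl mM) (bilin_Zr mM) model_hmul_xi.
set g'' := (_ * g * _)%g;
have g''m : (g'' \^ m = (s' \^ l')^-1 * (g \^ m) * s')%g.
  by rewrite 2!bconjM bconjV !(bconjD bbD) subrK addNr (bconj0 bbD).
have -> : ((s' * (bb m')^-1)%g \^ l' * (g' \^ m') * (s' * (bb m')^-1)^-1 =
           (s' \^ l') * g' * s'^-1)%g.
  rewrite bconjM bconjV bconj_bb {2}/bconj invMg invgK !mulgA.
  by rewrite !mulgKV.
have -> : (g \^ m == (s' \^ l') * g' * s'^-1)%g = (g'' \^ m == g').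
  rewrite g''m; move: (s' \^ l') (g \^ m) => S G; apply/eqP/eqP => [->|<-].
    by rewrite !mulgA mulVg mul1g mulgKV.
  by rewrite !mulgA mulgV mul1g mulgK.
case: (l =P l') => [<-|_]; last by rewrite (raw_lin0 lt) !scaler0.
case: (g'' \^ m =P g') => [<-|_]; last by rewrite (raw_lin0 lt) !scaler0.
rewrite theta_BB scalerA -wpD -opprD -mulrDr (bconjD bbD) /=; congr (_ *: xi k _ _ _).
by rewrite /bconj (bbN bbD) invgK addrC bbD invMg !mulgA mulgK.
Qed.

Lemma theta_one : theta (hone sdouble) = hone M.
Proof.
have lt := theta_linear.
rewrite sdouble_one (raw_lin_sum _ _ _ lt) [hone M]/=.
rewrite -(pair_bigA _ (fun l g => xi k 1%g l g)).
apply: eq_bigr => l _; rewrite (raw_lin_sum _ _ _ lt); apply: eq_bigr => g _.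
by rewrite theta_BB mulr0 oppr0 wp0 scale1r (bb0 bbD) invg1 mulg1 (bconj0 bbD).
Qed.

Lemma theta_counit d : counit (theta d) = counit d.
Proof.
have lt := theta_linear; have eM := @model_counit_linear k gT q bb.
move: d; apply: sdouble_ext => [||s l g m].
- exact: (linear_comp eM lt).
- exact: sdouble_counit_linear.
rewrite theta_BB (raw_linZ _ _ eM) model_counit_xi sdouble_counit.
case: eqP => [->|_]; last by rewrite [LHS]mulr0.
rewrite mul0r oppr0 wp0 scale1r.
by rewrite /bconj -{1}(mulgV (bb m)) (inj_eq (mulIg _)) -{2}[bb m]mulg1 (inj_eq (mulgI _)).
Qed.

Lemma theta_comul d : comul (theta d) = sw2 (fun x y => theta x \ot theta y) d.
Proof.
have lt := theta_linear; have pb := pure_bilin M M.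
move: d; apply: sdouble_ext => [||s l g m].
- exact: (linear_comp (@model_comul_linear k gT q bb) lt).
- exact: sw2_linear sdouble_comul_linear.
rewrite sdouble_sw2; last exact: (bilin_comp pb).
rewrite theta_BB (raw_linZ _ _ (@model_comul_linear k gT q bb)) model_comul_xi.
rewrite -(pair_bigA _ (fun n x => (xi k ((s * (bb m)^-1)%g \^ n) (l - n) x : M) \ot
   (xi k (s * (bb m)^-1)%g n (x^-1 * (g \^ m))%g : M))) scaler_sumr.
apply: eq_bigr => n _; rewrite (reindex_inj (can_inj (bconjK bbD m))) /= scaler_sumr.
apply: eq_bigr => x _; rewrite !theta_BB (bilin_Zl pb) (bilin_Zr pb) scalerA.
rewrite -wpD -opprD -mulrDl subrK.
have -> : ((s * (bb m)^-1) \^ n = (s \^ n) * (bb m)^-1)%g.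
  by rewrite bconjM -(bbN bbD) bconj_bb.
by rewrite bconjM bconjV.
Qed.

(** A linear section of [theta], onto the span of the basis elements without
    x-component. *)
Definition emb (u : M) : sdouble :=
  \sum_x (u : {ffun gT * 'Z_q * gT -> k^o}) x *: BB x.1.1 x.1.2 x.2 0.

Lemma emb_linear : linear emb.
Proof. exact: ext1_linear. Qed.

Lemma emb_xi s l g : emb (xi k s l g) = BB s l g 0.
Proof. exact: (sum_delta_lin (fun x => BB x.1.1 x.1.2 x.2 0)). Qed.

Lemma embK : cancel emb theta.
Proof.
have lt := theta_linear.
apply: xi_ext => [|//|s l g]; first exact: (linear_comp lt emb_linear).
by rewrite emb_xi theta_BB mulr0 oppr0 wp0 scale1r (bb0 bbD) invg1 mulg1 (bconj0 bbD).
Qed.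

Lemma sdouble_mul1r d : hmul d (hone sdouble) = d.
Proof.
have mD := sdouble_hmul_bilin.
move: d; apply: sdouble_ext => [|//|s l g m]; first exact: (bilin_l _ mD).
rewrite sdouble_one (bilin_sumr mD) (sum_pick (i := l)) => [|l' nl]; last first.
  rewrite (bilin_sumr mD) big1 // => g' _; by rewrite BB_mul [l == _]eq_sym (negPf nl).
rewrite (bilin_sumr mD) (sum_pick (i := g \^ m)) => [|g' ng].
by rewrite BB_mul !bconj1 invg1 !mul1g !mulg1 !eqxx addr0.
by rewrite BB_mul !bconj1 invg1 !mul1g !mulg1 eqxx eq_sym (negPf ng).
Qed.

(** The element chi x, expanded in the basis of the double. *)
Definition grp_elt : sdouble := \sum_l \sum_g wp l *: BB (bb 1%R) l g 1.

Lemma BB_grp_elt s l g m : hmul (BB s l g m) grp_elt =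
  wp l *: BB (s * bb 1%R)%g l (g \^ (-1)) (m + 1).
Proof.
have mD := sdouble_hmul_bilin.
rewrite /grp_elt (bilin_sumr mD) (sum_pick (i := l)) => [|l' nl]; last first.
  rewrite (bilin_sumr mD) big1 // => g' _.
  rewrite (bilin_Zr mD) BB_mul [l == _]eq_sym (negPf nl).
  by rewrite scaler0.
have e : ((bb 1%R)^-1 * g * bb 1%R)%g = g \^ (-1) by rewrite /bconj (bbN bbD) invgK.
rewrite (bilin_sumr mD) (sum_pick (i := g \^ (-1) \^ m)) => [|g' ng].
  by rewrite (bilin_Zr mD) BB_mul !bconj_bb e !eqxx.
by rewrite (bilin_Zr mD) BB_mul !bconj_bb e eqxx eq_sym (negPf ng) scaler0.
Qed.

Lemma theta_grp_elt : theta grp_elt = hone M.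
Proof.
have lt := theta_linear.
rewrite /grp_elt (raw_lin_sum _ _ _ lt) [hone M]/= -(pair_bigA _ (fun l g => xi k 1%g l g)).
apply: eq_bigr => l _; rewrite (raw_lin_sum _ _ _ lt).
rewrite [RHS](reindex_inj (can_inj (bconjK bbD 1))) /=.
apply: eq_bigr => g _; rewrite (raw_linZ _ _ lt) theta_BB scalerA -wpD mulr1 subrr wp0.
by rewrite scale1r mulgV.
Qed.

Definition grp_ideal := left_ideal_gen (aug_cyclic grp_elt q).

Lemma mem_left_ideal (y x : sdouble) : x \in aug_cyclic grp_elt q -> hmul y x \in grp_ideal.
Proof.
have mD := sdouble_hmul_bilin.
move=> Wx; rewrite (coord_vbasis Wx) (coord_vbasis (memvf y)) (bilin_suml mD).
apply: rpred_sum => i _; rewrite (bilin_Zl mD) rpredZ // (bilin_sumr mD).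
apply: rpred_sum => j _; rewrite (bilin_Zr mD) rpredZ //.
by apply: memv_span; apply: allpairs_f; apply: mem_nth; rewrite size_tuple.
Qed.

(** A combination of powers of chi x goes to the sum of its coefficients, since
    [theta] is multiplicative and sends chi x to 1. *)
Lemma theta_span x : x \in <<[seq hexp grp_elt i | i <- iota 0 q]>>%VS ->
  theta x = counit x *: hone M.
Proof.
have lt := theta_linear; have eD := sdouble_counit_linear.
have eM := @model_counit_linear k gT q bb.
have lF : linear (fun y : sdouble => theta y - counit y *: hone M).
  by move=> c u v; rewrite lt eD scalerDl -scalerA scalerBr opprD addrACA.
have hexp_one i : theta (hexp grp_elt i) = hone M.
  elim: i => [|i IHi]; first exact: theta_one.
  rewrite /hexp iterS -/(hexp grp_elt i) theta_mul IHi theta_grp_elt -theta_one -theta_mul.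
  by rewrite sdouble_mul1r.
have counit_one : counit (hone M) = 1.
  rewrite (raw_lin_sum _ _ _ eM) (sum_pick (i := (0, 1%g))) => [|[l g]].
    by rewrite model_counit_xi !eqxx.
  by rewrite model_counit_xi xpair_eqE => /negPf->.
suff sub : (<<[seq hexp grp_elt i | i <- iota 0 q]>> <=
    lker (linfun (fun y : sdouble => theta y - counit y *: hone M)))%VS.
  move/(subvP sub); rewrite memv_ker raw_linfunE // subr_eq0 => /eqP.
  by [].
apply/span_subvP=> _ /mapP[i _ ->]; rewrite memv_ker raw_linfunE //.
by rewrite -theta_counit hexp_one counit_one scale1r subrr.
Qed.

Lemma theta_grp_ideal x : x \in grp_ideal -> theta x = 0.
Proof.
have lt := theta_linear; have mM := @model_hmul_bilin k gT q bb.
suff sub : (grp_ideal <= lker (linfun theta))%VS.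
  by move/(subvP sub); rewrite memv_ker raw_linfunE // => /eqP.
apply/span_subvP=> _ /allpairsP[[d y] /= [_ Wy ->]].
rewrite memv_ker raw_linfunE // theta_mul.
move: (vbasis_mem Wy); rewrite memv_cap memv_ker raw_linfunE; last exact: sdouble_counit_linear.
by case/andP=> /theta_span-> /eqP->; rewrite scale0r (bilin_0r mM).
Qed.

Hypothesis q_gt1 : (1 < q)%N.

Lemma grp_elt_sub1_aug : grp_elt - hone sdouble \in aug_cyclic grp_elt q.
Proof.
have eD := sdouble_counit_linear.
rewrite memv_cap; apply/andP; split.
  apply: rpredB; apply: memv_span; apply/mapP; last first.
    by exists 0%N; rewrite // mem_iota (ltnW q_gt1).
  by exists 1%N; rewrite ?mem_iota //; exact: esym (sdouble_mul1r grp_elt).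
rewrite memv_ker raw_linfunE // (raw_linD _ _ eD) -scaleN1r (raw_linZ _ _ eD).
by rewrite -!theta_counit theta_grp_elt theta_one scaleN1r subrr.
Qed.

Lemma quot_proj_linear : linear (quot_proj grp_ideal).
Proof. by move=> c x y; rewrite /quot_proj !linearP. Qed.

(** Since y (chi x) - y lies in the ideal for every y, the x-component can be
    lowered by one at the cost of a scalar. *)
Lemma BB_step s l g m : quot_proj grp_ideal (BB s l g (m + 1)) =
  wp (- l) *: quot_proj grp_ideal (BB (s * (bb 1%R)^-1)%g l (g \^ 1) m).
Proof.
have lp := quot_proj_linear; have mD := sdouble_hmul_bilin.
set y := BB _ l _ m.
have : quot_proj grp_ideal (hmul y grp_elt - y) = 0.
  apply/eqP; rewrite quot_proj_eq0 -{2}[y]sdouble_mul1r -scaleN1r -(bilin_Zr mD).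
  rewrite -(raw_linD _ _ (bilin_r y mD)) scaleN1r.
  exact: mem_left_ideal grp_elt_sub1_aug.
rewrite BB_grp_elt mulgKV (bconjK bbD) -scaleN1r (raw_linD _ _ lp) !(raw_linZ _ _ lp) scaleN1r.
by move/eqP; rewrite subr_eq0 => /eqP<-; rewrite scalerA -wpD addNr wp0 scale1r.
Qed.

Lemma BB_reduce s l g m : quot_proj grp_ideal (BB s l g m) =
  wp (- (l * m)) *: quot_proj grp_ideal (BB (s * (bb m)^-1)%g l (g \^ m) 0).
Proof.
rewrite -[m]natr_Zp; elim: (m : nat) s g => [|n IHn] s g.
  by rewrite mulr0 oppr0 wp0 scale1r (bb0 bbD) invg1 mulg1 (bconj0 bbD).
rewrite -natr1 BB_step IHn scalerA -wpD -opprD mulrDr mulr1 [l + _]addrC.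
by rewrite (bconjD bbD) [1 + _]addrC bbD invMg mulgA.
Qed.

Lemma quot_emb_theta (d : sdouble) :
  quot_proj grp_ideal (emb (theta d)) = quot_proj grp_ideal d.
Proof.
have lp := quot_proj_linear; have lt := theta_linear; have le := emb_linear.
move: d; apply: sdouble_ext => [||s l g m] //; first exact: (linear_comp lp (linear_comp le lt)).
by rewrite theta_BB (raw_linZ _ _ le) (raw_linZ _ _ lp) emb_xi [RHS]BB_reduce.
Qed.

Lemma theta_quot d : theta (vsval (quot_proj grp_ideal d)) = theta d.
Proof.
have lp := quot_proj_linear; have lt := theta_linear.
have : theta (vsval (quot_proj grp_ideal d) - d) = 0.
  apply: theta_grp_ideal; rewrite -quot_proj_eq0 -scaleN1r (raw_linD _ _ lp) (raw_linZ _ _ lp).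
  by rewrite quot_projK scaleN1r subrr.
by rewrite -scaleN1r (raw_linD _ _ lt) (raw_linZ _ _ lt) scaleN1r => /eqP; rewrite subr_eq0 => /eqP.
Qed.

(** [theta] vanishes on the ideal, and by [quot_emb_theta] the class of d is
    determined by [theta d]; so [theta] induces an isomorphism on the quotient,
    and it respects the structure maps because it does so on the double. *)
Lemma quot_model : hopf_iso (quot_hopf grp_ideal) M.
Proof.
have lp := quot_proj_linear; have lt := theta_linear.
pose f (x : quot_hopf grp_ideal) : M := theta (vsval x).
have lf : linear f by move=> c x y; rewrite /f linearP lt.
have fE := raw_linfunE lf.
exists (linfun f); last first.
  exists (fun u => quot_proj grp_ideal (emb u)) => u; rewrite fE /f.
    by rewrite quot_emb_theta quot_projK.
  by rewrite theta_quot embK.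
split=> [x y||x|x]; rewrite !fE.
- by rewrite /f theta_quot theta_mul.
- by rewrite /f theta_quot theta_one.
- have bf : bilin (fun x1 x2 : quot_hopf grp_ideal => linfun f x1 \ot linfun f x2).
    by apply: (bilin_comp (pure_bilin M M)); apply: linfun_linear.
  rewrite {1}/f theta_comul /sw2.
  rewrite -[in RHS]/(tlift (fun d1 d2 => quot_proj grp_ideal d1 \ot quot_proj grp_ideal d2)
                           (comul (vsval x))) tlift_map //.
  by apply: eq_tlift => d1 d2; rewrite !fE /f !theta_quot.
- by rewrite /f theta_counit.
Qed.

End Bismash.

(** * Trivial factors *)

Lemma trivial_no_abelian_factor_dim (k : closedFieldType) (char0 : [pchar k] =i pred0)
    (H : hopf_data k) : is_trivial H -> no_abelian_factor H -> \dim {: H} = 1%N.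
Proof.
move=> [gT [iso|iso]] naf; have nafG := hopf_iso_no_abelian_factor iso naf.
  have [cG triv] := group_hopf_only_trivial_char nafG.
  by rewrite (hopf_iso_dim iso) ffun_dim; apply: abelian_only_trivial_char_card1 triv.
have [cG triv] := dual_group_hopf_only_trivial_char nafG.
by rewrite (hopf_iso_dim iso) dual_dim ffun_dim; apply: abelian_only_trivial_char_card1 triv.
Qed.

(** * The metacyclic group *)

Lemma Zp_prime_unit p (x : 'Z_p) : prime p -> x != 0 -> x \is a GRing.unit.
Proof.
move=> hp nzx; have p1 := prime_gt1 hp.
rewrite -[x]natr_Zp unitZpE // prime_coprime // gtnNdvd //.
  by rewrite lt0n; apply: contra nzx => /eqP x0; apply/eqP/val_inj.
by rewrite -{2}(Zp_cast p1) ltn_ord.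
Qed.

Section MetacyclicFacts.
Variables (p q t : nat).
Hypotheses (hp : prime p) (hq : prime q) (ht : t ^ q = 1 %[mod p]) (ht1 : t <> 1 %[mod p]).
Local Notation G := (metacyclic hp hq ht).

(** This is [mc_b ^+ l]; as a pair it visibly turns sums into products. *)
Definition bpow (l : 'Z_q) : G := (0, l).

Lemma bpowD l m : bpow (l + m) = (bpow l * bpow m)%g.
Proof. by rewrite mc_mulE /mc_mul /= mulr0 addr0. Qed.

Lemma mc_actE (g : G) l : mc_act g l = bconj bpow g l.
Proof.
case: g => i j; rewrite /bconj !mc_mulE -[(_^-1)%g]/(mc_inv _) /mc_mul /mc_inv /mc_act /=.
by rewrite !mulr0 oppr0 mulr0 addr0 add0r addrAC subrr add0r.
Qed.

Lemma mc_t_neq1 : (t%:R : 'Z_p) != 1.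
Proof.
apply/eqP => e; have : t%:R = 1%:R :> 'Z_p := e.
by move/(congr1 (@nat_of_ord _)); rewrite !val_Zp_nat ?prime_gt1.
Qed.

Lemma mc_cent_b (s : G) : commute s (bpow 1%R) -> s.1 = 0.
Proof.
case: s => i j /(congr1 fst); rewrite !mc_mulE /mc_mul /= mulr0 addr0 add0r.
rewrite -{1}[i]mul1r => e; apply/eqP; apply: contraT => /(Zp_prime_unit hp) Ui.
have := mulIr Ui e; rewrite modn_small // expr1 => /esym/eqP.
by rewrite (negPf mc_t_neq1).
Qed.

(** Commuting with b kills the a-component, since t - 1 is invertible mod p.
    Commuting with a then says that t^j = 1 mod p, and as t has order exactly
    q, this forces j = 0 mod q. *)
Lemma mc_center (z : G) : (forall s, commute z s) -> z = 1%g.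
Proof.
move=> Zz; have := mc_cent_b (Zz _); case: z Zz => i j Zz /= i0; rewrite {}i0 in Zz *.
have /(congr1 fst) := Zz (mc_a hp hq ht).
rewrite !mc_mulE /mc_mul /= mulr1 add0r mulr0 addr0 => tj.
have [m prim_m m_q] := prim_order_exists (prime_gt0 hq) (mc_tq hp ht).
case: (primeP hq) => _ /(_ m m_q) /orP[/eqP m1|/eqP mq].
  by have := prim_expr_order prim_m; rewrite m1 expr1 => /eqP; rewrite (negPf mc_t_neq1).
have : (m %| j)%N by rewrite (prim_order_dvd prim_m) tj.
rewrite mq.
have jq : (j < q)%N by rewrite -{2}(Zp_cast (prime_gt1 hq)) ltn_ord.
case: (posnP j) => [j0 _|j_gt0]; last by rewrite gtnNdvd.
by congr (_, _); apply: val_inj.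
Qed.

Lemma mc_cent_bpow (s s' : G) : (forall l, commute s (bpow l)) ->
  (forall l, commute s' (bpow l)) -> commute s s'.
Proof.
move=> cs cs'; have [s1 s1'] := (mc_cent_b (cs 1), mc_cent_b (cs' 1)).
case: s s' s1 s1' {cs cs'} => [i j] [i' j'] /= -> ->.
by rewrite /commute !mc_mulE /mc_mul /= !mulr0 addr0 addrC.
Qed.

End MetacyclicFacts.

Lemma unity_root_exprD (R : comRingType) q (w : R) (l m : 'Z_q) : (1 < q)%N ->
  w ^+ q = 1 -> w ^+ (l + m)%R = w ^+ l * w ^+ m.
Proof.
move=> q1 wq; rewrite -exprD [in RHS](divn_eq (l + m) q) exprD mulnC exprM wq expr1n mul1r.
congr (_ ^+ _); exact: (congr1 (modn (l + m)) (Zp_cast q1)).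
Qed.

(** * The Hopf algebra A(p,q) *)

Section ApqModel.
Variables (k : fieldType) (p q t : nat).
Hypotheses (hp : prime p) (hq : prime q) (ht : t ^ q = 1 %[mod p]).
Variables (w : k) (wq : w ^+ q = 1).

Lemma chi_xE : chi_x hp hq ht w =
  @grp_elt k _ q (@bpow p q t hp hq ht) (@mc_act p q t hp hq ht) (fun l => w ^+ l).
Proof.
have pb := pure_bilin (dual_hopf (A0 k hp hq ht)) (A0 k hp hq ht).
have chiE : A0_chi hp hq ht w = \sum_(l : 'Z_q)
      w ^+ l *: EE k (@mc_act p q t hp hq ht) (bpow hp hq ht 1%R) l.
  apply: dual_ext => -[g l]; rewrite /A0_chi raw_linfunE; last first.
    move=> c x y; rewrite scaler_sumr -big_split; apply: eq_bigr => m _ /=.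
    by rewrite !ffunE mulrDl -scalerAl.
  rewrite sum_lfunE; apply: eq_bigr => m _.
  by rewrite scale_lfunE dual_deltaE [LHS]mulrC.
rewrite /chi_x chiE (bilin_suml pb); apply: eq_bigr => l _.
by rewrite (bilin_Zl pb) /A0_x (bilin_sumr pb) scaler_sumr.
Qed.

Lemma Apq_model : hopf_iso (Apq hp hq ht w) (model k (@bpow p q t hp hq ht)).
Proof.
rewrite /Apq chi_xE; apply: quot_model.
- exact: bpowD.
- exact: mc_actE.
- by [].
- by move=> l m; apply: unity_root_exprD => //; apply: prime_gt1.
- exact: prime_gt1.
Qed.

End ApqModel.

Theorem theorem4p25 (k : closedFieldType) (char0 : [pchar k] =i pred0)
    (p q t : nat) (hp : prime p) (hq : prime q) (oddp : odd p) (oddq : odd q)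
    (hpq : p = 1 %[mod q]) (ht : t ^ q = 1 %[mod p]) (ht1 : t <> 1 %[mod p])
    (w : k) (hw : q.-primitive_root w) :
  ~ exists (n : nat) (Hs : 'I_n -> hopf_data k),
      (forall i, is_hopf (Hs i) /\ (is_trivial (Hs i) \/ is_drinfeld_double (Hs i)))
      /\ hopf_iso (Apq hp hq ht w) (big_tensor Hs).
Proof.
move=> [n [Hs [hHs iso]]].
have isoM := Apq_model hp hq ht (prim_expr_order hw).
have nafM : no_abelian_factor (model k (@bpow p q t hp hq ht)).
  apply: model_no_abelian_factor.
  - exact: bpowD.
  - exact: mc_center.
  - by move=> l /(congr1 snd).
  - exact: mc_cent_bpow.
have nafT := hopf_iso_no_abelian_factor iso
  (hopf_iso_no_abelian_factor (hopf_iso_sym isoM) nafM).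
have naf := big_tensor_no_abelian_factor (fun i => proj1 (hHs i)) nafT.
have square i : exists m, \dim {: Hs i} = (m * m)%N.
  case: (hHs i) => _ [triv|[H0 _ dbl]].
    by exists 1%N; rewrite (trivial_no_abelian_factor_dim char0 triv (naf i)).
  by exists (\dim {: H0}); rewrite (hopf_iso_dim dbl) double_dim.
have [m dimT] : exists m, \dim {: big_tensor Hs} = (m * m)%N.
  rewrite big_tensor_dim; apply: (big_ind (fun d => exists m, d = m * m)%N).
  - by exists 1%N.
  - by move=> _ _ [a ->] [b ->]; exists (a * b)%N; rewrite mulnACA.
  - by move=> i _; apply: square.
have := hopf_iso_dim isoM; rewrite (hopf_iso_dim iso) dimT ffun_dim !card_prod !card_ord.
have [p1 q1] := (prime_gt1 hp, prime_gt1 hq); rewrite !Zp_cast // => dimE.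
have pq_gt0 : (0 < p * q)%N by rewrite muln_gt0 !prime_gt0.
have m_gt0 : (0 < m)%N.
  suff : (0 < m * m)%N by rewrite muln_gt0 => /andP[].
  by rewrite dimE !muln_gt0 !prime_gt0.
(* The exponent of q is even in m * m and odd in p * q * q * (p * q). *)
have := congr1 (odd \o logn q) dimE.
rewrite /= !lognM ?muln_gt0 ?(prime_gt0 hp) ?(prime_gt0 hq) // (logn_prime q hq) eqxx !oddD addbb.
by case: (odd _).
Qed.
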